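(* Let $s\ge 0$. A weakly continuous $\mathscr P$-valued path $(\mu_t)_{t\ge s}$ is a solution from time $s$ of the nonlinear Fokker-Planck equation $\partial_t\mu_t=L^*_{t,\mu_t}\mu_t$ if and only if the $\mathscr P(\mathscr P)$-valued path $(\delta_{\mu_t})_{t\ge s}$ is a solution from time $s$ of the linear first order Fokker-Planck equation $\partial_t\Gamma_t=(\mathbf L_t)^*\Gamma_t$ (with $\Gamma_t=\delta_{\mu_t}$).
   Context: Let $d,m\in\mathbb N$. $\mathscr P$ is the set of Borel probability measures on $\mathbb R^d$ with the weak topology and its Borel $\sigma$-algebra; $\mathscr P(\mathscr P)$ is the set of Borel probability measures on $\mathscr P$, also with the weak topology; $\delta_\mu$ is the Dirac measure at $\mu\in\mathscr P$; $\mu(h):=\int h\,d\mu$. $C_0^k(\mathbb R^d)$ denotes compactly supported $C^k$ functions; $C_b^1(\mathbb R^n)$ denotes bounded $C^1$ functions with bounded first derivatives. Let $b:[0,\infty)\times\mathbb R^d\times\mathscr P\to\mathbb R^d$ and $\sigma:[0,\infty)\times\mathbb R^d\times\mathscr P\to\mathbb R^d\otimes\mathbb R^m$ be Borel measurable, and put $$L_{t,\mu}h(x)=\tfrac12\sum_{i,j=1}^d(\sigma\sigma^* )_{ij}(t,x,\mu)\partial_i\partial_jh(x)+\sum_{i=1}^db_i(t,x,\mu)\partial_ih(x).$$ Nonlinear equation: $(\mu_t)_{t\ge s}$, weakly continuous in $\mathscr P$, is a solution of $\partial_t\mu_t=L^*_{t,\mu_t}\mu_t$ from time $s$ if for all $t\ge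 s$: $\int_s^tdr\int_{\mathbb R^d}(|b|+\|\sigma\|^2)(r,x,\mu_r)\,\mu_r(dx)<\infty$ and $\int h\,d\mu_t=\int h\,d\mu_s+\int_s^tdr\int L_{r,\mu_r}h\,d\mu_r$ for all $h\in C_0^\infty(\mathbb R^d)$. Test functions on $\mathscr P$: $\mathscr FC_b^2(\mathscr P)$ is the set of $F(\mu)=g(\mu(h_1),\dots,\mu(h_n))$ with $n\ge1$, $g\in C_b^1(\mathbb R^n)$, $h_i\in C_0^2(\mathbb R^d)$. For such $F$, $\nabla^{\mathscr P}F(\mu)=\sum_{i=1}^n\partial_ig(\mu(h_1),\dots,\mu(h_n))\nabla h_i$, and $$\mathbf L_tF(\mu)=\Big\langle\tfrac12(\sigma\sigma^* )(t,\cdot,\mu)\nabla+b(t,\cdot,\mu),\nabla^{\mathscr P}F(\mu)\Big\rangle_{L^2(\mathbb R^d\to\mathbb R^d,\mu)}:=\sum_{i=1}^n\partial_ig(\mu(h_1),\dots,\mu(h_n))\int_{\mathbb R^d}L_{t,\mu}h_i\,d\mu .$$ Linear equation: $(\Gamma_t)_{t\ge s}$, weakly continuous in $\mathscr P(\mathscr P)$, is a solution of $\partial_t\Gamma_t=(\mathbf L_t)^*\Gamma_t$ from time $s$ if for all $t\ge s$: $\int_s^tdr\int_{\mathscr P}\big|(|b|+\|\sigma\|^2)(r,\cdot,\mu)\big|_{L^1(\mathbb R^d,\mu)}\Gamma_r(d\mu)<\infty$ and $\int F\,d\Gamma_t=\int F\,d\Gamma_s+\int_s^tdr\int_{\mathscr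 P}\mathbf L_rF\,d\Gamma_r$ for all $F\in\mathscr FC_b^2(\mathscr P)$. *)

(* Defs.v *)
From HB Require Import structures.
From mathcomp Require Import all_boot all_order all_algebra.
From mathcomp Require Import all_classical all_reals all_analysis.
Set Implicit Arguments.
Unset Strict Implicit.
Unset Printing Implicit Defensive.
Import Order.TTheory GRing.Theory Num.Theory.
Import numFieldNormedType.Exports.
Local Open Scope classical_set_scope.
Local Open Scope ring_scope.

(* The library has no such join for products. *)
HB.instance Definition _ (T U : ptopologicalType) :=
  Topological.on (T * U)%type.

(** * Borel probability measures with the weak topology *)

Definition borel (T : ptopologicalType) : measurableType (@open T).-sigma :=
  g_sigma_algebraType (@open T).

Definition borel_fun (T U : ptopologicalType) (D : set T) (f : T -> U) : Prop :=
  measurable_fun (D : set (borel T)) (f : borel T -> borel U).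

Record bcfun (R : realType) (T : topologicalType) := BCFun {
  bcfun_val :> T -> R ;
  bcfun_continuous : continuous bcfun_val ;
  bcfun_bounded : bounded_fun bcfun_val }.

(* Measures of the library are set functions on all sets, so two probabilities
   that agree on the Borel sets need not be equal in this type; they are
   topologically indistinguishable, hence not separated by Borel sets or Borel
   functions on [prob R T]. *)
Definition prob (R : realType) (T : ptopologicalType) : Type :=
  probability (borel T) R.

HB.instance Definition _ (R : realType) (T : ptopologicalType) :=
  Pointed.copy (prob R T) (probability (borel T) R).

(* Coarsest topology making all mu |-> \int f dmu continuous, f bounded and
   continuous. *)
HB.instance Definition _ (R : realType) (T : ptopologicalType) :=
  Topological.copy (prob R T)
    (sup_topology (fun f : bcfun R T => Topological.on
       (initial_topology (fun mu : probability (borel T) R =>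
          (\int[mu]_x f x : R))))).

Definition pdirac (R : realType) (T : ptopologicalType) (x : T) : prob R T :=
  [the probability (borel T) R of @dirac _ (borel T) x R].

(* Weak continuity of a path indexed by [s, +oo[; values before s are
   irrelevant. *)
Definition weakly_continuous_from (R : realType) (T : ptopologicalType) (s : R)
    (G : R -> prob R T) : Prop :=
  {within `[s, +oo[%classic, continuous G}.

(** * Test functions *)

Definition partial (R : realType) (n : nat) (i : 'I_n) (h : 'rV[R]_n -> R)
    (x : 'rV[R]_n) : R :=
  'D_(delta_mx 0 i) h x.

Fixpoint Ck (R : realType) (n k : nat) (h : 'rV[R]_n -> R) : Prop :=
  if k is k'.+1 then
    continuous h /\
    forall i : 'I_n, (forall x, derivable h x (delta_mx 0 i)) /\
                     Ck k' (partial i h)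
  else continuous h.

Definition compactly_supported (R : realType) (n : nat)
    (h : 'rV[R]_n -> R) : Prop :=
  compact (closure [set x | h x != 0]).

Definition C0k (R : realType) (n k : nat) (h : 'rV[R]_n -> R) : Prop :=
  Ck k h /\ compactly_supported h.

Definition C0oo (R : realType) (n : nat) (h : 'rV[R]_n -> R) : Prop :=
  (forall k, Ck k h) /\ compactly_supported h.

Definition Cb1 (R : realType) (n : nat) (g : 'rV[R]_n -> R) : Prop :=
  [/\ Ck 1 g, bounded_fun g & forall i : 'I_n, bounded_fun (partial i g)].

(* In both equations the real-valued integrals (set to 0 by the library when
   infinite) are used together with the integrability condition, under which
   the time-space integrands are integrable. *)

(** * The operators and the two Fokker-Planck equations *)

Section FokkerPlanck.
Variables (R : realType) (d m : nat).
Local Notation P := (prob R 'rV[R]_d).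
Variables (b : R -> 'rV[R]_d -> P -> 'rV[R]_d)
          (sigma : R -> 'rV[R]_d -> P -> 'M[R]_(d, m)).

(* Euclidean norm of a row vector, Hilbert-Schmidt norm of a matrix; the norm
   [`|A|] of the library is the entrywise maximum. *)
Definition fnorm (p q : nat) (A : 'M[R]_(p, q)) : R :=
  Num.sqrt (\sum_i \sum_j A i j ^+ 2).

Definition coeff_size (t : R) (mu : P) (x : 'rV[R]_d) : R :=
  fnorm (b t x mu) + fnorm (sigma t x mu) ^+ 2.

Definition Lop (t : R) (mu : P) (h : 'rV[R]_d -> R) (x : 'rV[R]_d) : R :=
  2^-1 * (\sum_i \sum_j (sigma t x mu *m (sigma t x mu)^T) i j
                        * partial i (partial j h) x)
  + \sum_i b t x mu 0 i * partial i h x.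

Definition nonlinear_FPE_solution (s : R) (mu : R -> P) : Prop :=
  weakly_continuous_from s mu /\
  forall t, s <= t ->
    (\int[lebesgue_measure]_(r in `[s, t])
       \int[mu r]_x (coeff_size r (mu r) x)%:E < +oo)%E /\
    forall h, C0oo h ->
      \int[mu t]_x h x = \int[mu s]_x h x
        + \int[lebesgue_measure]_(r in `[s, t])
            \int[mu r]_x Lop r (mu r) h x.

Definition moments (n : nat) (h : 'I_n -> 'rV[R]_d -> R) (mu : P) : 'rV[R]_n :=
  \row_i \int[mu]_x h i x.

Definition cyl (n : nat) (g : 'rV[R]_n -> R) (h : 'I_n -> 'rV[R]_d -> R)
    (mu : P) : R :=
  g (moments h mu).

(* L_t F for F = cyl g h, written with the presentation (g, h) of F; the linear
   equation is required for every presentation of every cylinder function. *)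
Definition bfLop (t : R) (n : nat) (g : 'rV[R]_n -> R)
    (h : 'I_n -> 'rV[R]_d -> R) (mu : P) : R :=
  \sum_i partial i g (moments h mu) * \int[mu]_x Lop t mu (h i) x.

Definition linear_FPE_solution (s : R) (Gamma : R -> prob R P) : Prop :=
  weakly_continuous_from s Gamma /\
  forall t, s <= t ->
    (\int[lebesgue_measure]_(r in `[s, t])
       \int[Gamma r]_mu 'N[mu]_1[EFin \o coeff_size r mu] < +oo)%E /\
    forall (n : nat) (g : 'rV[R]_n -> R) (h : 'I_n -> 'rV[R]_d -> R),
      (1 <= n)%N -> Cb1 g -> (forall i, C0k 2 (h i)) ->
      \int[Gamma t]_mu cyl g h mu = \int[Gamma s]_mu cyl g h mu
        + \int[lebesgue_measure]_(r in `[s, t])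
            \int[Gamma r]_mu bfLop r g h mu.

End FokkerPlanck.

(* Main.v *)
From HB Require Import structures.
Require Import Defs.
From mathcomp Require Import all_boot all_order all_algebra.
From mathcomp Require Import all_classical all_reals all_analysis.
From mathcomp Require Import measurable_realfun.
From mathcomp Require Import ring lra zify.
Set Implicit Arguments.
Unset Strict Implicit.
Unset Printing Implicit Defensive.
Import Order.TTheory GRing.Theory Num.Theory.
Import numFieldNormedType.Exports.
Local Open Scope classical_set_scope.
Local Open Scope ring_scope.

(** For Gamma_t = delta_(mu_t) every integral against Gamma_t is an evaluation
at mu_t, so the linear equation says exactly that, for all g and h_1, ..., h_n,
the function g(mu_t(h_1), ..., mu_t(h_n)) obeys the chain rule along the path,
the time derivative of mu_t(h_i) being the integral of L_(t, mu_t) h_i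
([chain_rule_along], [linear_FPE_pdirac]).  Evaluating needs measurability of
the integrands in the measure variable: evaluation on a Borel set of R^d is a
Borel function of mu ([measurable_prob_eval]), hence mu |-> mu is a transition
kernel, and an integral of a jointly measurable function against a kernel is
measurable.  Joint measurability in turn rests on the Borel sets of X * R^d being
measurable for the product sigma-algebra ([open_prod_rV]).

From the chain rule to the nonlinear equation, it is enough to take n = 1 and a
bounded g that is the identity on the range of mu_t(h): a coordinate times a
smooth cutoff.

In the other direction two things are needed.

First, the nonlinear equation is required for smooth h only, while the cylinder
functions use h of class C^2.  The equation for h extends to uniform limits of h,
grad h and Hess h, because |L h| is at most a constant times
(|b| + |sigma|^2) (|grad h| + |Hess h|) and the coefficients are integrable in time
and space ([smooth_to_C2_equation]).  Smooth functions are dense for this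
convergence ([C0oo_dense]): on a box containing the support of h, the Bernstein
polynomials of h converge to h together with their first and second partial
derivatives ([Ck2_poly_approx]), and a smooth cutoff equal to 1 on that support
makes them compactly supported.

Second, y_t = (mu_t(h_1), ..., mu_t(h_n)) is an indefinite integral of an
integrable function, and the chain rule holds for a C^1 function g of such a curve
([chain_rule_integral]).  Over a short time interval the defect in the chain rule
is at most eps times the integral of |y'|; such bounds add up over adjacent
intervals, hence hold globally, and eps is arbitrary. *)

(** * Borel sets of products with R^d *)

Lemma measurable_to_borel d (X : measurableType d) (U : ptopologicalType)
    (f : X -> U) :
  (forall A : set U, open A -> measurable (f @^-1` A)) ->
  measurable_fun setT (f : X -> borel U).
Proof.
move=> fo; apply: (@measurability _ _ X (borel U) setT f (@open U) erefl) => _ [B oB <-].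
by rewrite setTI; exact: fo.
Qed.

Lemma open_borel (U : ptopologicalType) (A : set U) :
  open A -> measurable (A : set (borel U)).
Proof. by move=> oA; apply: sub_sigma_algebra. Qed.

Lemma continuous_borel_real (R : realType) (U : ptopologicalType) (f : U -> R) :
  continuous f -> measurable_fun setT (f : borel U -> R).
Proof.
move=> cf; apply: (measurability _ (RGenOInfty.measurableE R)).
move=> _ [_ [x ->] <-]; rewrite setTI; apply: open_borel.
by apply: open_comp; [move=> ? _; exact: cf|exact: interval_open].
Qed.

Lemma continuous_borel (U V : ptopologicalType) (f : U -> V) :
  continuous f -> measurable_fun setT (f : borel U -> borel V).
Proof.
move=> cf; apply: measurable_to_borel => A oA; apply: open_borel.
by apply: open_comp => // x _; exact: cf.
Qed.

Lemma measurable_borelR d (X : measurableType d) (R : realType) (f : X -> R) :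
  measurable_fun setT f -> measurable_fun setT (f : X -> borel R).
Proof.
move=> mf; apply: measurable_to_borel => A oA.
by rewrite -[X in measurable X]setTI; apply: mf => //; exact: open_measurable.
Qed.

(** Balls with rational centre and radius 1 / (k + 1) form a countable base of
R^d, indexed by q. *)
Lemma rV_rational_ball (R : realType) (n : nat) (U : set 'rV[R]_n) x :
  open U -> U x ->
  exists q : 'rV[rat]_n * nat,
    ball (map_mx (@ratr R) q.1) q.2.+1%:R^-1 x /\
    ball (map_mx (@ratr R) q.1) q.2.+1%:R^-1 `<=` U.
Proof.
rewrite openE => oU /oU; rewrite /interior -nbhs_ballE => -[e /= e0 eU].
have [N Ne] : exists N : nat, N.+1%:R^-1 < e / 2.
  have := @near_infty_natSinv_lt R (PosNum (divr_gt0 e0 (ltr0n R 2))).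
  by case=> N _ HN; exists N; apply: HN => /=.
have N0 : 0 < N.+1%:R^-1 :> R by rewrite invr_gt0.
have q_ (i : 'I_n) : exists q : rat, `|ratr q - x 0 i| < N.+1%:R^-1.
  have [|q] := @rat_in_itvoo R (x 0 i - N.+1%:R^-1) (x 0 i + N.+1%:R^-1).
    by rewrite ltrBlDr -addrA ltrDl addr_gt0.
  rewrite in_itv/= => /andP[q1 q2]; exists q.
  by rewrite ltr_norml ltrBrDl q1 ltrBlDl q2.
pose q := \row_i sval (cid (q_ i)).
have qx : ball (map_mx (@ratr R) q : 'rV[R]_n) N.+1%:R^-1 x.
  by split=> // i j; rewrite !mxE ord1 /ball/=; case: cid.
exists (q, N); split => //= y qy; apply: eU.
apply: (@ball_splitr _ _ (map_mx (@ratr R) q) ).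
  by apply: le_ball qx; exact: ltW.
by apply: le_ball qy; exact: ltW.
Qed.

(** An open set of X * R^d is the union over the countable base (B_q) of R^d of
the products V_q * B_q, where V_q is the union of the open sets of X whose product
with B_q stays inside.  As one second countable factor makes the union countable,
X may be the space of probability measures. *)
Lemma open_prod_rV (R : realType) (n : nat) (X : ptopologicalType)
  (U : set (X * 'rV[R]_n)) : open U ->
  measurable (U : set (borel X * borel 'rV[R]_n)).
Proof.
move=> oU.
pose B (q : 'rV[rat]_n * nat) : set 'rV[R]_n :=
  ball (map_mx (@ratr R) q.1) q.2.+1%:R^-1.
pose V (q : 'rV[rat]_n * nat) : set X :=
  [set x | exists A, [/\ open A, A x & A `*` B q `<=` U]].
have oV q : open (V q).
  rewrite openE => x [A [oA Ax AB]]; rewrite /interior nbhsE/=.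
  by exists A => // y Ay; exists A.
have oB q : open (B q) by apply: ball_open; rewrite invr_gt0.
have -> : U = \bigcup_(q in [set: 'rV[rat]_n * nat]) (V q `*` B q).
  apply/seteqP; split => [[x y] Uxy|[x y] [q _ [/= [A [_ Ax AB]] By]]]; last first.
    by apply: AB.
  move: oU; rewrite openE => /(_ _ Uxy) -[[P Q] /= [Px Qy] PQ].
  move: Px; rewrite nbhsE => -[P' [oP' P'x] P'P].
  move: Qy; rewrite nbhsE => -[Q' [oQ' Q'y] Q'Q].
  have [q [qy qQ]] := rV_rational_ball oQ' Q'y.
  exists q => //; split=> //=; exists P'; split=> // -[a b] [/= Pa Bb].
  by apply: PQ; split=> /=; [exact: P'P|apply: Q'Q; exact: qQ].
apply: countable_bigcupT_measurable => [|q]; first exact: countableP.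
by apply: measurableX; exact: open_borel.
Qed.

(** * The weak topology on probability measures *)

Lemma continuous_bcfun_integral (R : realType) (T : ptopologicalType)
  (f : bcfun R T) : continuous (fun mu : prob R T => \int[mu]_x f x : R).
Proof.
move=> mu.
have /cvg_sup/(_ f) h : nbhs mu --> mu by exact: cvg_id.
have := (@initial_continuous (probability (borel T) R) R (fun nu => \int[nu]_x f x) mu).
move=> k U /k kU; exact: (h _ kU).
Qed.

Lemma continuous_prob (R : realType) (T : ptopologicalType) (Y : topologicalType)
  (G : Y -> prob R T) :
  (forall f : bcfun R T, continuous (fun y => \int[G y]_x f x : R)) ->
  continuous G.
Proof.
move=> cG y; apply/cvg_sup => f.
exact: (@continuous_comp_initial (probability (borel T) R) Y R (fun nu => \int[nu]_x f x) G (cG f)).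
Qed.

Lemma prob_integrable_bounded (R : realType) (T : ptopologicalType)
  (mu : prob R T) (f : T -> R) :
  measurable_fun setT (f : borel T -> R) -> bounded_fun f ->
  mu.-integrable setT (EFin \o (f : borel T -> R)).
Proof.
move=> mf bf; apply: measurable_bounded_integrable => //.
by rewrite (le_lt_trans (probability_le1 mu measurableT))// ltry.
Qed.

Lemma bcfun_integrable (R : realType) (T : ptopologicalType) (mu : prob R T)
  (f : bcfun R T) : mu.-integrable setT (EFin \o (f : borel T -> R)).
Proof.
case: f => f cf bf; apply: prob_integrable_bounded => //=.
exact: continuous_borel_real.
Qed.

Lemma measurable_prob_bcfun (R : realType) (T : ptopologicalType)
  (f : bcfun R T) :
  measurable_fun setT (fun mu : borel (prob R T) => (\int[mu]_x (f x)%:E)%E).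
Proof.
have -> : (fun mu : borel (prob R T) => (\int[mu]_x (f x)%:E)%E) =
   EFin \o (fun mu : prob R T => \int[mu]_x f x).
  apply/funext => mu/=; rewrite fineK//; apply: integrable_fin_num => //.
  exact: bcfun_integrable.
apply/measurable_EFinP; apply: continuous_borel_real.
exact: continuous_bcfun_integral.
Qed.

(** The indicator function of U is the pointwise limit of the bounded continuous
functions min(1, k dist(x, ~` U)), so by dominated convergence mu U is a pointwise
limit of weakly continuous functions of mu. *)
Lemma measurable_prob_open (R : realType) (n : nat) (U : set 'rV[R]_n) :
  open U ->
  measurable_fun setT (fun mu : borel (prob R 'rV[R]_n) => mu U).
Proof.
move=> oU; pose C := ~` U.
(* The distance to an empty set is infinite. *)
have [C0|/set0P[c Cc]] := eqVneq C set0.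
  have -> : U = setT by rewrite -(setCK U) -/C C0 setC0.
  have -> : (fun mu : borel (prob R 'rV[R]_n) => mu setT) = cst 1%E.
    by apply/funext => mu; rewrite probability_setT.
  exact: measurable_cst.
pose dist x := fine (@edist_inf R 'rV[R]_n C x).
have dfin x : @edist_inf R 'rV[R]_n C x \is a fin_num.
  rewrite ge0_fin_numE ?edist_inf_ge0 //.
  apply: (@le_lt_trans _ _ (edist (x, c))).
    by apply: ereal_inf_lbound; exists c.
  rewrite -ge0_fin_numE ?edist_ge0 //; apply/edist_finP => /=.
  exists (`|x - c| + 1); first by rewrite ltr_wpDl.
  by rewrite -ball_normE /ball_/= ltrDl.
have dcont : continuous dist.
  move=> x; rewrite /continuous_at /dist; apply: fine_cvg.
    exact: nbhs_filter.
  by rewrite fineK//; exact: edist_inf_continuous.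
have d0 x : C x -> dist x = 0 by move=> Cx; rewrite /dist edist_inf0.
have dge0 x : 0 <= dist x by rewrite /dist fine_ge0 ?edist_inf_ge0.
have dpos x : U x -> 0 < dist x.
  move: (oU); rewrite openE => /(_ x) /[apply]; rewrite /interior -nbhs_ballE.
  move=> -[e /= e0 eU]; apply: (lt_le_trans e0).
  rewrite -lee_fin /dist fineK//; apply: le_ereal_inf_tmp => _ /= [a Ca <-].
  by rewrite leNgt; apply/negP => /edist_lt_ball /eU.
pose f_ k x := Num.min 1 (k%:R * dist x).
have f_01 k x : 0 <= f_ k x <= 1.
  by rewrite /f_ le_min ge_min lexx/= ler01/= andbT mulr_ge0.
have f_c k : continuous (f_ k).
  move=> x; apply: (@continuous_min R _ (fun=> 1) (fun y => k%:R * dist y) x).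
    exact: cst_continuous.
  by apply: continuousM; [exact: cst_continuous|exact: dcont].
have f_b k : bounded_fun (f_ k).
  exists 1; split => // M M1 x _ /=.
  have /andP[a b] := f_01 k x.
  by rewrite ger0_norm// (le_trans b)// ltW.
pose F k := BCFun (f_c k) (f_b k).
have fU x : f_ ^~ x @ \oo --> (\1_U x : R).
  have [Ux|nUx] := pselect (U x); last first.
    rewrite indicE memNset// (_ : f_ ^~ x = cst 0); first exact: cvg_cst.
    by apply/funext => k; rewrite /f_ d0// mulr0 min_r.
  rewrite indicE mem_set//; apply: cvg_near_cst.
  have := dpos _ Ux; set D := dist x => D0.
  near=> k; rewrite /f_ min_l// -ler_pdivrMr// div1r.
  near: k; exact: nbhs_infty_ger.
apply: (emeasurable_fun_cvg (fun k (mu : borel (prob R 'rV[R]_n)) => (\int[mu]_x (F k x)%:E)%E)).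
  by move=> k; exact: measurable_prob_bcfun.
move=> mu _.
have mU : measurable (U : set (borel 'rV[R]_n)) by exact: open_borel.
have -> : mu U = (\int[mu]_x (\1_(U : set (borel 'rV[R]_n)) x)%:E)%E.
  by rewrite integral_indic// setIT.
apply: (@dominated_cvg _ _ _ _ _ measurableT (fun k (x : borel 'rV[R]_n) => (F k x)%:E)
   (fun x => (\1_(U : set (borel 'rV[R]_n)) x)%:E) (cst 1%E)) => //.
- by move=> k; apply/measurable_EFinP; exact: (@continuous_borel_real R _ (f_ k) (f_c k)).
- move=> x _; apply/fine_cvgP; split; [exact: nearW|exact: fU].
- exact: (@finite_measure_integrable_cst _ _ _ mu setT 1).
- move=> k x _ /=; have /andP[a b] := f_01 k x.
  by rewrite lee_fin ger0_norm.
Unshelve. all: by end_near. Qed.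

(** Open sets are stable under intersection and generate the Borel sets, so
Dynkin's theorem extends the case of open sets. *)
Lemma measurable_prob_eval (R : realType) (n : nat) (A : set (borel 'rV[R]_n)) :
  measurable A ->
  measurable_fun setT (fun mu : borel (prob R 'rV[R]_n) => mu A).
Proof.
move=> mA.
apply: (@dynkin_induction _ (borel 'rV[R]_n) (@open 'rV[R]_n)
  [set A | measurable_fun setT (fun mu : borel (prob R 'rV[R]_n) => mu A)]) => //.
- by move=> B C; exact: openI.
- by apply: measurable_prob_open; exact: openT.
- by move=> B oB; exact: measurable_prob_open.
- move=> S mS /= mf.
  have -> : (fun mu : borel (prob R 'rV[R]_n) => mu (~` S)) = (fun mu : borel (prob R 'rV[R]_n) => 1 - mu S)%E.
    by apply/funext => mu; rewrite probability_setC.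
  exact: emeasurable_funB.
- move=> F mF tF /= mFf.
  have -> : (fun mu : borel (prob R 'rV[R]_n) => mu (\bigcup_k F k)) =
     (fun mu : borel (prob R 'rV[R]_n) => \sum_(0 <= k <oo) mu (F k))%E.
    by apply/funext => mu; rewrite measure_semi_bigcup//; exact: bigcup_measurable.
  by apply: ge0_emeasurable_sum.
Qed.

(** * Measurability of integrals along a family of measures *)

(** The family k as a transition kernel.  The proof of measurability is an argument
because the kernel instances declared next are inferred from the term. *)
Definition prob_kernel (R : realType) (n : nat) d (X : measurableType d)
  (k : X -> prob R 'rV[R]_n)
  (mk : forall A : set (borel 'rV[R]_n), measurable A ->
     measurable_fun setT (fun x => k x A)) :
  X -> {measure set (borel 'rV[R]_n) -> \bar R} := k.

HB.instance Definition _ (R : realType) (n : nat) d (X : measurableType d)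
  (k : X -> prob R 'rV[R]_n) mk :=
  isKernel.Build _ _ X (borel 'rV[R]_n) R (@prob_kernel R n d X k mk) mk.

HB.instance Definition _ (R : realType) (n : nat) d (X : measurableType d)
  (k : X -> prob R 'rV[R]_n) mk :=
  Kernel_isProbability.Build _ _ X (borel 'rV[R]_n) R (@prob_kernel R n d X k mk)
    (fun x => probability_setT (k x)).

Section KernelIntegral.
Variables (R : realType) (n : nat) (d : measure_display) (X : measurableType d).
Variable k : X -> prob R 'rV[R]_n.
Hypothesis mk : forall A : set (borel 'rV[R]_n), measurable A ->
     measurable_fun setT (fun x => k x A).

Lemma measurable_integral_prob (f : X * borel 'rV[R]_n -> \bar R) :
  (forall z, 0 <= f z)%E -> measurable_fun setT f ->
  measurable_fun setT (fun x => \int[k x]_y f (x, y))%E.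
Proof.
move=> f0 mf.
exact: (measurable_fun_integral_finite_kernel f (@prob_kernel R n d X k mk)).
Qed.

Lemma measurable_Rintegral_prob (f : X * borel 'rV[R]_n -> R) :
  measurable_fun setT f ->
  measurable_fun setT (fun x => \int[k x]_y f (x, y)).
Proof.
move=> mf; rewrite /Rintegral.
apply: (measurableT_comp (fine_measurable measurableT)).
under eq_fun do rewrite integralE.
have mF : measurable_fun setT (fun z => (f z)%:E) by exact/measurable_EFinP.
apply: emeasurable_funB.
- under eq_fun do under eq_integral do rewrite funeposE.
  apply: (@measurable_integral_prob (fun z => maxe (f z)%:E 0)).
    by move=> z; rewrite le_max lexx orbT.
  exact: measurable_maxe.
- under eq_fun do under eq_integral do rewrite funenegE.
  apply: (@measurable_integral_prob (fun z => maxe (- (f z)%:E) 0)%E).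
    by move=> z; rewrite le_max lexx orbT.
  by apply: measurable_maxe => //; exact: measurableT_comp.
Qed.

End KernelIntegral.

Lemma continuous_pair_fun (X Y Z : topologicalType) (f : X -> Y) (g : X -> Z) :
  continuous f -> continuous g -> continuous (fun x => (f x, g x)).
Proof.
move=> cf cg x; apply: (@cvg_pair _ _ _ (nbhs x) (nbhs (f x)) (nbhs (g x))).
  exact: cf.
exact: cg.
Qed.

Lemma fst_continuous (X Y : topologicalType) : continuous (@fst X Y).
Proof. by move=> x; exact: cvg_fst. Qed.

Lemma snd_continuous (X Y : topologicalType) : continuous (@snd X Y).
Proof. by move=> x; exact: cvg_snd. Qed.

Section Coefficients.
Variables (R : realType) (d m : nat).
Local Notation V := 'rV[R]_d.
Local Notation P := (prob R V).
Variables (b : R -> V -> P -> V) (sigma : R -> V -> P -> 'M[R]_(d, m)).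
Hypothesis hb : borel_fun [set z : R * V * P | 0 <= z.1.1]
  (fun z => b z.1.1 z.1.2 z.2).
Hypothesis hsigma : borel_fun [set z : R * V * P | 0 <= z.1.1]
  (fun z => sigma z.1.1 z.1.2 z.2).

Lemma measurable_nonneg_time :
  measurable ([set z : R * V * P | 0 <= z.1.1] : set (borel (R * V * P)%type)).
Proof.
rewrite -[X in measurable X]setCK; apply: measurableC; apply: open_borel.
have -> : ~` [set z : R * V * P | 0 <= z.1.1] =
  (fun z : R * V * P => z.1.1) @^-1` `]-oo, 0[.
  by apply/seteqP; split=> z /=; rewrite in_itv/= ltNge => /negP.
apply: open_comp; last exact: interval_open.
by move=> z _; apply: (@continuous_comp _ _ _ fst fst); exact: fst_continuous.
Qed.

Variables (Y : ptopologicalType) (tau : Y -> R) (k : Y -> P).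
Hypothesis tau0 : forall y, 0 <= tau y.
Hypothesis tauc : continuous tau.
Hypothesis kc : continuous k.

(** The point (tau y, x, k y) is a continuous function of (y, x), and the
coefficients are Borel functions of it.  This serves both with y ranging over the
measures and the time fixed, and with y the time and k a path of measures. *)
Lemma measurable_along (p q : nat) (c : R -> V -> P -> 'M[R]_(p, q)) i j :
  borel_fun [set z : R * V * P | 0 <= z.1.1] (fun z => c z.1.1 z.1.2 z.2) ->
  measurable_fun setT (fun z : borel Y * borel V => c (tau z.1) z.2 (k z.1) i j).
Proof.
move=> hc.
pose phi (z : Y * V) : R * V * P := (tau z.1, z.2, k z.1).
have cphi : continuous phi.
  apply: (@continuous_pair_fun _ (R * V)%type P (fun z => (tau z.1, z.2)) (k \o fst)).
    apply: (@continuous_pair_fun _ R V (tau \o fst) snd); last exact: snd_continuous.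
    by move=> z; apply: continuous_comp; [exact: fst_continuous|exact: tauc].
  by move=> z; apply: continuous_comp; [exact: fst_continuous|exact: kc].
have mphi : measurable_fun setT
    (phi : borel Y * borel V -> borel (R * V * P)%type).
  apply: measurable_to_borel => A oA; apply: open_prod_rV.
  by apply: open_comp => // z _; exact: cphi.
have mc : measurable_fun setT
   ((fun z => c z.1.1 z.1.2 z.2 : borel 'M[R]_(p, q)) \o
     (phi : borel Y * borel V -> borel (R * V * P)%type)).
  apply: (measurable_comp measurable_nonneg_time _ hc mphi).
  by move=> _ [z _ <-] /=.
exact: (measurableT_comp (@continuous_borel_real R 'M[R]_(p, q)
  (fun M => M i j) (@coord_continuous _ _ _ i j)) mc).
Qed.

Lemma measurable_along_fnorm (p q : nat) (c : R -> V -> P -> 'M[R]_(p, q)) :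
  borel_fun [set z : R * V * P | 0 <= z.1.1] (fun z => c z.1.1 z.1.2 z.2) ->
  measurable_fun setT (fun z : borel Y * borel V => fnorm (c (tau z.1) z.2 (k z.1))).
Proof.
move=> hc; pose g := fun z : borel Y * borel V =>
  \sum_i \sum_j c (tau z.1) z.2 (k z.1) i j ^+ 2.
have mg : measurable_fun setT g.
  apply: measurable_sum => i; apply: measurable_sum => j.
  by apply: measurable_funX; exact: measurable_along.
exact: (measurableT_comp (continuous_measurable_fun (@sqrt_continuous R)) mg).
Qed.

Lemma measurable_along_size :
  measurable_fun setT (fun z : borel Y * borel V =>
    coeff_size b sigma (tau z.1) (k z.1) z.2).
Proof.
apply: measurable_funD; first exact: measurable_along_fnorm.
by apply: measurable_funX; exact: measurable_along_fnorm.
Qed.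

Lemma measurable_along_Lop (h : V -> R) :
  (forall i, continuous (partial i h)) ->
  (forall i j, continuous (partial i (partial j h))) ->
  measurable_fun setT (fun z : borel Y * borel V =>
    Lop b sigma (tau z.1) (k z.1) h z.2).
Proof.
move=> h1 h2; apply: measurable_funD.
  apply: measurable_funM; first exact: measurable_cst.
  apply: measurable_sum => i; apply: measurable_sum => j.
  apply: measurable_funM.
    under eq_fun do rewrite mxE.
    apply: measurable_sum => l; apply: measurable_funM; first exact: measurable_along.
    by under eq_fun do rewrite mxE; exact: measurable_along.
  by apply: (measurableT_comp (continuous_borel_real (h2 i j))); exact: measurable_snd.
apply: measurable_sum => i; apply: measurable_funM; first exact: measurable_along.
by apply: (measurableT_comp (continuous_borel_real (h1 i))); exact: measurable_snd.
Qed.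

Lemma measurable_k_eval (A : set (borel V)) : measurable A ->
  measurable_fun setT (fun y : borel Y => k y A).
Proof.
move=> mA; apply: (measurableT_comp (measurable_prob_eval mA)).
exact: continuous_borel.
Qed.

Lemma measurable_along_int_size :
  measurable_fun setT (fun y : borel Y =>
    \int[k y]_x (coeff_size b sigma (tau y) (k y) x)%:E)%E.
Proof.
apply: (@measurable_integral_prob R d _ (borel Y) k measurable_k_eval
  (fun z => (coeff_size b sigma (tau z.1) (k z.1) z.2)%:E)).
  by move=> z; rewrite lee_fin addr_ge0 ?exprn_ge0 ?sqrtr_ge0.
by apply/measurable_EFinP; exact: measurable_along_size.
Qed.

Lemma measurable_along_int_Lop (h : V -> R) :
  (forall i, continuous (partial i h)) ->
  (forall i j, continuous (partial i (partial j h))) ->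
  measurable_fun setT (fun y : borel Y =>
    \int[k y]_x Lop b sigma (tau y) (k y) h x).
Proof.
move=> h1 h2.
apply: (@measurable_Rintegral_prob R d _ (borel Y) k measurable_k_eval
  (fun z => Lop b sigma (tau z.1) (k z.1) h z.2)).
exact: measurable_along_Lop.
Qed.

End Coefficients.

(** * Integrals against Dirac masses *)

Lemma integral_pdirac (R : realType) (U : ptopologicalType) (a : U)
  (f : U -> \bar R) : measurable_fun setT (f : borel U -> \bar R) ->
  (\int[pdirac R a]_x f x)%E = f a.
Proof.
move=> mf; rewrite /pdirac/=.
by rewrite (@integral_dirac _ (borel U) (a : borel U) R setT measurableT f mf) diracT mul1e.
Qed.

Lemma Rintegral_pdirac (R : realType) (U : ptopologicalType) (a : U)
  (f : U -> R) : measurable_fun setT (f : borel U -> R) ->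
  \int[pdirac R a]_x f x = f a.
Proof.
by move=> mf; rewrite /Rintegral integral_pdirac//; exact/measurable_EFinP.
Qed.

Lemma pdirac_continuous (R : realType) (U : ptopologicalType) (Y : topologicalType)
  (k : Y -> U) : continuous k -> continuous (fun y => pdirac R (k y)).
Proof.
move=> kc; apply: continuous_prob => f.
have -> : (fun y => \int[pdirac R (k y)]_x f x) = f \o k.
  apply/funext => y; apply: Rintegral_pdirac.
  exact: (continuous_borel_real (@bcfun_continuous _ _ f)).
move=> y; apply: continuous_comp; first exact: kc.
exact: (@bcfun_continuous _ _ f).
Qed.

(** * Compactly supported functions and moments *)

Section CompactSupport.
Variables (R : realType) (n : nat).

Lemma compactly_supported_bounded (h : 'rV[R]_n -> R) :
  continuous h -> compactly_supported h -> exists M, forall x, `|h x| <= M.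
Proof.
move=> ch cs.
have : compact (h @` closure [set x | h x != 0]).
  by apply: continuous_compact => //; exact: continuous_subspaceT.
move=> /compact_bounded[M [_ HM]].
exists (`|M| + 1) => x.
have [->|hx] := eqVneq (h x) 0; first by rewrite normr0 addr_ge0.
apply: (HM (`|M| + 1)).
  by rewrite (le_lt_trans (ler_norm _))// ltrDl.
by exists x => //; exact: subset_closure.
Qed.

Lemma Ck_continuous k (h : 'rV[R]_n -> R) : Ck k h -> continuous h.
Proof. by case: k => [//|k] []. Qed.

Lemma Ck1_partial_continuous k (h : 'rV[R]_n -> R) i : Ck k.+1 h ->
  continuous (partial i h).
Proof. by move=> [_ /(_ i)[_ /Ck_continuous]]. Qed.

Lemma Ck2_partial_continuous k (h : 'rV[R]_n -> R) i j : Ck k.+2 h ->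
  continuous (partial i (partial j h)).
Proof. by move=> [_ /(_ j)[_ /Ck1_partial_continuous]]. Qed.

Lemma compactly_supported_bounded_fun (h : 'rV[R]_n -> R) :
  continuous h -> compactly_supported h -> bounded_fun h.
Proof.
move=> hc hs; have [M hM] := compactly_supported_bounded hc hs.
exists M; split; first exact: num_real.
by move=> N MN x _ /=; rewrite (le_trans (hM x))// ltW.
Qed.

Lemma continuous_moment (h : 'rV[R]_n -> R) :
  continuous h -> compactly_supported h ->
  continuous (fun mu : prob R 'rV[R]_n => \int[mu]_x h x : R).
Proof.
move=> hc hs.
exact: (@continuous_bcfun_integral R 'rV[R]_n
  (BCFun hc (compactly_supported_bounded_fun hc hs))).
Qed.

Lemma continuous_row (X : topologicalType) (q : nat) (f : X -> 'rV[R]_q) :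
  (forall i, continuous (fun x => f x 0 i)) -> continuous f.
Proof.
move=> cf x A [B Bx BA]; rewrite /nbhs/=.
apply: (@filterS _ (nbhs x) _ _ _ (fun y (Hy : forall i : 'I_1, forall j, B i j (f y i j)) => BA _ Hy)).
apply: filter_forall => i; apply: filter_forall => j.
rewrite ord1; apply: cf; rewrite -(ord1 0); exact: Bx.
Qed.

Lemma continuous_moments (q : nat) (h : 'I_q -> 'rV[R]_n -> R) :
  (forall i, continuous (h i)) -> (forall i, compactly_supported (h i)) ->
  continuous (moments h : prob R 'rV[R]_n -> 'rV[R]_q).
Proof.
move=> hc hs; apply: continuous_row => i.
under eq_fun do rewrite mxE; exact: continuous_moment.
Qed.

End CompactSupport.

(** * The linear equation for a path of Dirac masses *)

Section DiracLinear.
Variables (R : realType) (d m : nat).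
Local Notation V := 'rV[R]_d.
Local Notation P := (prob R V).
Variables (b : R -> V -> P -> V) (sigma : R -> V -> P -> 'M[R]_(d, m)).
Hypothesis hb : borel_fun [set z : R * V * P | 0 <= z.1.1]
  (fun z => b z.1.1 z.1.2 z.2).
Hypothesis hsigma : borel_fun [set z : R * V * P | 0 <= z.1.1]
  (fun z => sigma z.1.1 z.1.2 z.2).

Lemma coeff_size_ge0 t mu x : 0 <= coeff_size b sigma t mu x.
Proof. by rewrite addr_ge0 ?exprn_ge0 ?sqrtr_ge0. Qed.

Lemma measurable_int_size t : 0 <= t ->
  measurable_fun setT (fun mu : borel P => \int[mu]_x (coeff_size b sigma t mu x)%:E)%E.
Proof.
move=> t0; exact: (@measurable_along_int_size R d m b sigma hb hsigma P
  (fun=> t) id (fun=> t0) (@cst_continuous _ _ t) (fun x => cvg_id)).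
Qed.

Lemma measurable_bfLop t n (g : 'rV[R]_n -> R) (h : 'I_n -> V -> R) :
  0 <= t -> Ck 1 g -> (forall i, C0k 2 (h i)) ->
  measurable_fun setT (bfLop b sigma t g h : borel P -> R).
Proof.
move=> t0 g1 h2; apply: measurable_sum => i; apply: measurable_funM.
  have c1 : continuous (partial i g \o moments h : P -> R).
    move=> mu; apply: continuous_comp; last exact: (Ck1_partial_continuous (k := 0)).
    by apply: continuous_moments => j; have [/Ck_continuous] := h2 j.
  exact: (continuous_borel_real c1).
apply: (@measurable_along_int_Lop R d m b sigma hb hsigma P
  (fun=> t) id (fun=> t0) (@cst_continuous _ _ t) (fun x => cvg_id) (h i)).
- by move=> j; apply: (Ck1_partial_continuous (k := 1)); have [] := h2 i.
- by move=> j l; apply: (Ck2_partial_continuous (k := 0)); have [] := h2 i.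
Qed.

(** The linear equation for Gamma_t = delta_(mu_t), with the integrals against
Dirac masses evaluated. *)
Definition chain_rule_along (s : R) (mu : R -> P) : Prop :=
  forall t, s <= t ->
    (\int[lebesgue_measure]_(r in `[s, t])
       \int[mu r]_x (coeff_size b sigma r (mu r) x)%:E < +oo)%E /\
    forall (n : nat) (g : 'rV[R]_n -> R) (h : 'I_n -> V -> R),
      (1 <= n)%N -> Cb1 g -> (forall i, C0k 2 (h i)) ->
      cyl g h (mu t) = cyl g h (mu s)
        + \int[lebesgue_measure]_(r in `[s, t]) bfLop b sigma r g h (mu r).

(** The integral against a Dirac mass evaluates measurable integrands only,
which is why the Borel measurability of the coefficients matters here. *)
Lemma linear_FPE_pdirac (s : R) (mu : R -> P) : 0 <= s ->
  weakly_continuous_from s mu ->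
  linear_FPE_solution b sigma s (fun t => pdirac R (mu t)) <->
  chain_rule_along s mu.
Proof.
move=> s0 cmu.
have r0 r t : r \in `[s, t]%classic -> 0 <= r.
  by rewrite inE/= in_itv/= => /andP[sr _]; exact: le_trans sr.
have E1 t : (\int[lebesgue_measure]_(r in `[s, t])
    \int[pdirac R (mu r)]_nu 'N[nu]_1[EFin \o coeff_size b sigma r nu])%E =
   (\int[lebesgue_measure]_(r in `[s, t])
     \int[mu r]_x (coeff_size b sigma r (mu r) x)%:E)%E.
  apply: eq_integral => r rst.
  under eq_integral => nu _.
    rewrite Lnorm1.
    under eq_integral => x _ do rewrite /= ger0_norm ?coeff_size_ge0//.
    over.
  rewrite integral_pdirac//; apply: measurable_int_size; exact: r0 rst.
have E2 t n g (h : 'I_n -> V -> R) : Cb1 g -> (forall i, C0k 2 (h i)) ->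
    \int[pdirac R (mu t)]_nu cyl g h nu = cyl g h (mu t).
  move=> [g1 _ _] h2; apply: Rintegral_pdirac; apply: continuous_borel_real.
  move=> nu; apply: (@continuous_comp _ _ _ (moments h) g).
    apply: continuous_moments => j; first by have [/Ck_continuous] := h2 j.
    by have [] := h2 j.
  exact: (Ck_continuous g1).
have E3 t n g (h : 'I_n -> V -> R) : Cb1 g -> (forall i, C0k 2 (h i)) ->
    \int[lebesgue_measure]_(r in `[s, t])
      \int[pdirac R (mu r)]_nu bfLop b sigma r g h nu =
    \int[lebesgue_measure]_(r in `[s, t]) bfLop b sigma r g h (mu r).
  move=> [g1 _ _] h2; apply: eq_Rintegral => r rst.
  by rewrite Rintegral_pdirac//; apply: measurable_bfLop => //; exact: r0 rst.
split=> [[_ H] t st|H].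
  have [H1 H2] := H t st; split; first by rewrite -E1.
  by move=> n g h n1 Hg Hh; rewrite -!E2// -E3//; exact: H2.
split; first exact: (pdirac_continuous cmu).
move=> t st; have [H1 H2] := H t st; split; first by rewrite E1.
by move=> n g h n1 Hg Hh; rewrite !E2// E3//; exact: H2.
Qed.

End DiracLinear.

(** * Increments and partial derivatives *)

Section Line.
Variables (R : realType) (n : nat).
Implicit Types (g : 'rV[R]_n -> R) (z : 'rV[R]_n).

Lemma is_derive_line g z (e : 'rV[R]_n) (t : R) :
  derivable g (z + t *: e) e ->
  is_derive t 1 (fun u : R => g (z + u *: e)) ('D_e g (z + t *: e)).
Proof.
move=> dg.
have E : (fun h : R => h^-1 *: (((fun u : R => g (z + u *: e)) \o shift t) (h *: 1) - g (z + t *: e)))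
    = (fun h : R => h^-1 *: ((g \o shift (z + t *: e)) (h *: e) - g (z + t *: e))).
  apply/funext => h /=; congr (_ *: (g _ - _)).
  by rewrite -[h *: 1]/(h * 1) mulr1 scalerDl addrCA.
by split; rewrite /derivable /derive E.
Qed.

(** Mean value theorem along a coordinate line, in the form of a first order
error bound valid for steps of either sign. *)
Lemma line_increment g z (i : 'I_n) (t c eps : R) :
  (forall x, derivable g x (delta_mx 0 i)) ->
  (forall u, `|u| <= `|t| -> 0 <= u * t ->
     `|partial i g (z + u *: delta_mx 0 i) - c| <= eps) ->
  `|g (z + t *: delta_mx 0 i) - g z - c * t| <= eps * `|t|.
Proof.
move=> dg Hc.
pose phi (u : R) := g (z + u *: delta_mx 0 i).
have dphi (u : R) : is_derive u 1 phi (partial i g (z + u *: delta_mx 0 i)).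
  exact: is_derive_line.
have cphi (a b : R) : {within `[a, b], continuous phi}.
  by apply: derivable_within_continuous => u _; exact: (@ex_derive _ _ _ _ _ _ _ (dphi u)).
have phi0 : phi 0 = g z by rewrite /phi scale0r addr0.
rewrite -phi0 -/(phi t).
have [t0|t0|->] := ltrgtP t 0; last first.
- by rewrite mulr0 subr0 subrr normr0 mulr0.
- have [u /[!in_itv]/= /andP[u0 ut] ->] := MVT t0 (fun u _ => dphi u) (cphi 0 t).
  rewrite subr0 -mulrBl normrM ler_wpM2r//; apply: Hc.
    by rewrite !gtr0_norm// ltW.
  by rewrite mulr_ge0 ?ltW.
- have [u /[!in_itv]/= /andP[u0 ut] E] := MVT t0 (fun u _ => dphi u) (cphi t 0).
  rewrite -[phi t - phi 0]opprB E sub0r mulrN opprK -mulrBl normrM ler_wpM2r//; apply: Hc.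
    by rewrite !ltr0_norm// lerN2 ltW.
  by rewrite mulr_le0 ?ltW.
Qed.

Definition mixrow (l : seq 'I_n) (z w : 'rV[R]_n) : 'rV[R]_n :=
  \row_j (if j \in l then w 0 j else z 0 j).

Lemma mixrow_cons (i : 'I_n) l z w : i \notin l ->
  mixrow (i :: l) z w = mixrow l z w + (w 0 i - z 0 i) *: delta_mx 0 i.
Proof.
move=> il; apply/rowP => j; rewrite !mxE/= inE.
have [->|ji] := eqVneq j i; first by rewrite (negbTE il) mulr1 addrC subrK.
by rewrite mulr0 addr0.
Qed.

(** Moving from z to w one coordinate at a time uses partial derivatives only,
and all intermediate points stay in the ball of the maximum norm, which is a
product of intervals. *)
Lemma increment_le_partial g z (w x0 : 'rV[R]_n) (rho eps : R) (c : 'I_n -> R) :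
  (forall i x, derivable g x (delta_mx 0 i)) ->
  (forall i (x : 'rV[R]_n), (forall j, `|x 0 j - x0 0 j| < rho) -> `|partial i g x - c i| <= eps) ->
  (forall j, `|z 0 j - x0 0 j| < rho) -> (forall j, `|w 0 j - x0 0 j| < rho) ->
  `|g w - g z - \sum_i c i * (w 0 i - z 0 i)| <= eps * \sum_i `|w 0 i - z 0 i|.
Proof.
move=> dg Hc Hz Hw.
have H l : uniq l -> `|g (mixrow l z w) - g z - \sum_(i <- l) c i * (w 0 i - z 0 i)|
    <= eps * \sum_(i <- l) `|w 0 i - z 0 i|.
  elim: l => [_|i l IH /= /andP[il ul]].
    have -> : mixrow [::] z w = z by apply/rowP => j; rewrite mxE.
    by rewrite !big_nil subr0 subrr normr0 mulr0.
  rewrite !big_cons mixrow_cons// [eps * _]mulrDr.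
  have -> : g (mixrow l z w + (w 0 i - z 0 i) *: delta_mx 0 i) - g z -
     (c i * (w 0 i - z 0 i) + \sum_(j <- l) c j * (w 0 j - z 0 j)) =
    (g (mixrow l z w + (w 0 i - z 0 i) *: delta_mx 0 i) - g (mixrow l z w)
      - c i * (w 0 i - z 0 i)) +
    (g (mixrow l z w) - g z - \sum_(j <- l) c j * (w 0 j - z 0 j)) by ring.
  apply: (le_trans (ler_normD _ _)); apply: lerD; last exact: IH.
  apply: line_increment => // u u1 u2; apply: Hc => j; rewrite !mxE/=.
  have [->|ji] := eqVneq j i; last first.
    by rewrite mulr0 addr0; case: ifP.
  rewrite (negbTE il) mulr1; have := Hz i; have := Hw i.
  move: u1 u2; set a := w 0 i; set p := z 0 i; set q := x0 0 i => u1 u2.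
  rewrite !ltr_norml => /andP[h1 h2] /andP[h3 h4].
  have [ap|ap] := lerP 0 (a - p).
    have u0 : 0 <= u.
      move: ap; rewrite le_eqVlt => /predU1P[ap|ap]; last by rewrite -(pmulr_lge0 _ ap).
      by move: u1; rewrite -ap normr0 normr_le0 => /eqP ->.
    move: u1; rewrite !ger0_norm// => u1; lra.
  have u0 : u <= 0 by rewrite -(nmulr_lge0 _ ap).
  by move: u1; rewrite ler0_norm// ltr0_norm// => u1; lra.
have := H (enum 'I_n) (enum_uniq _).
rewrite !big_enum/=.
have -> // : mixrow (enum 'I_n) z w = w.
by apply/rowP => j; rewrite mxE mem_enum.
Qed.

End Line.

(** Cousin's lemma: a transitive relation between times that holds locally around
each time holds between the end points.  The supremum of the times related to a
is itself related to a, by the local hypothesis at the supremum, and could be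
exceeded if it were smaller than b. *)
Lemma interval_induction (R : realType) (a b : R) (F : R -> R -> Prop) : a <= b ->
  (forall u v w, a <= u -> u <= v -> v <= w -> w <= b -> F u v -> F v w -> F u w) ->
  (forall t, a <= t <= b -> exists2 e : R, 0 < e &
     forall u v, a <= u -> u <= t -> t <= v -> v <= b -> t - e < u -> v < t + e -> F u v) ->
  F a b.
Proof.
move=> ab Ftr Floc.
pose S := [set t | a <= t <= b /\ F a t].
have Sa : S a.
  split; first by rewrite lexx.
  have [|e e0 He] := Floc a; first by rewrite lexx.
  by apply: He => //; rewrite ?ltrBlDr ltrDl.
have hS : has_sup S by split; [exists a|exists b => t [/andP[]]].
pose t := sup S.
have at_ : a <= t by exact: (sup_upper_bound hS).
have tb : t <= b by apply: ge_sup; [exists a|move=> u [/andP[]]].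
have [|e e0 He] := Floc t; first by rewrite at_.
have [u [/andP[au ub] Fau] tu] := sup_adherent e0 hS.
have ut : u <= t by apply: (sup_upper_bound hS); split; rewrite ?au.
have Fv v : t <= v -> v <= b -> v < t + e -> F a v.
  move=> tv vb vte; apply: (Ftr a u v) => //; first exact: le_trans tv.
  by apply: He.
have [tb'|] := ltP t b; last by move=> bt; apply: Fv => //; apply: (le_lt_trans bt); rewrite ltrDl.
pose v := Num.min b (t + e / 2).
have tv : t < v by rewrite lt_min tb' ltrDl divr_gt0.
have : S v.
  have vb : v <= b by rewrite ge_min lexx.
  split; first by rewrite vb (le_trans at_)// ltW.
  apply: Fv => //; first exact: ltW.
  by rewrite gt_min; apply/orP; right; rewrite ltrD2l; lra.
by move=> /(sup_upper_bound hS); rewrite -/t leNgt tv.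
Qed.

(** * Chain rule for integral curves *)

Section RealIntegrable.
Context d (T : measurableType d) (R : realType).
Variables (mu : {measure set T -> \bar R}) (D : set T) (mD : measurable D).

Lemma real_integrable_sum (I : Type) (l : seq I) (f : I -> T -> R) :
  (forall i, mu.-integrable D (EFin \o f i)) ->
  mu.-integrable D (EFin \o (fun x => \sum_(i <- l) f i x)).
Proof.
move=> fi; apply: eq_integrable (integrable_sum mD l (P := xpredT) (fun i _ => fi i)) => //.
by move=> x _ /=; rewrite sumEFin.
Qed.

Lemma Rintegral_sum (I : Type) (l : seq I) (f : I -> T -> R) :
  (forall i, mu.-integrable D (EFin \o f i)) ->
  \int[mu]_(x in D) (\sum_(i <- l) f i x) = \sum_(i <- l) \int[mu]_(x in D) f i x.
Proof.
move=> fi; elim: l => [|i l IH].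
  by under eq_Rintegral do rewrite big_nil; rewrite Rintegral_cst// mul0r big_nil.
under eq_Rintegral do rewrite big_cons.
by rewrite big_cons -IH RintegralD//; exact: real_integrable_sum.
Qed.

Lemma real_integrableZ (k : R) (f : T -> R) : mu.-integrable D (EFin \o f) ->
  mu.-integrable D (EFin \o (fun x => k * f x)).
Proof. by move=> /(integrableZl mD k). Qed.

Lemma real_integrableB (f g : T -> R) : mu.-integrable D (EFin \o f) ->
  mu.-integrable D (EFin \o g) -> mu.-integrable D (EFin \o (fun x => f x - g x)).
Proof. by move=> fi gi; exact: (integrableB mD fi gi). Qed.

End RealIntegrable.

Section ChainRule.
Variables (R : realType) (n : nat) (g : 'rV[R]_n -> R) (s T : R).
Variables (y : R -> 'rV[R]_n) (a : 'I_n -> R -> R).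
Hypothesis sT : s <= T.
Hypothesis g1 : Ck 1 g.
Hypothesis cy : continuous y.
Local Notation mu := (@lebesgue_measure R).
Hypothesis ai : forall i, mu.-integrable `[s, T] (EFin \o a i).
Hypothesis ya : forall i t, s <= t <= T ->
  y t 0 i = y s 0 i + \int[mu]_(r in `[s, t]) a i r.

Let c_ i r := partial i g (y r).
Let f r := \sum_i c_ i r * a i r.
Let A r := \sum_i `|a i r|.

Let c_cont i : continuous (c_ i).
Proof.
by move=> r; apply: continuous_comp; [exact: cy|exact: (Ck1_partial_continuous (k := 0))].
Qed.

(** The factor is continuous, hence bounded on the compact interval. *)
Lemma chain_rule_integrable i :
  mu.-integrable `[s, T] (EFin \o (fun r => partial i g (y r) * a i r)).
Proof.
apply: (@integrableMr _ _ _ mu `[s, T]%classic _ (c_ i) (EFin \o a i)) => //.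
  by apply: measurable_funTS; exact: continuous_measurable_fun.
have := @compact_bounded R R^o (c_ i @` `[s, T]%classic).
have : compact (c_ i @` `[s, T]%classic).
  apply: continuous_compact; last exact: segment_compact.
  exact: continuous_subspaceT.
move=> /[swap] /[apply] -[M [Mr HM]]; exists M; split => // N MN x xD.
by apply: (HM N MN); exists x.
Qed.

Let fi : mu.-integrable `[s, T] (EFin \o f).
Proof. by apply: real_integrable_sum => // i; exact: chain_rule_integrable. Qed.

Let Ai : mu.-integrable `[s, T] (EFin \o A).
Proof. by apply: real_integrable_sum => // i; exact: integrable_norm. Qed.

Let J (h : R -> R) t := \int[mu]_(r in `[s, t]) h r.

Let JB h u v : mu.-integrable `[s, T] (EFin \o h) -> s <= u -> u <= v -> v <= T ->
  J h v - J h u = \int[mu]_(r in `]u, v]) h r.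
Proof.
move=> hi su uv vT; rewrite /J Rintegral_itvB ?bnd_simp//.
apply: integrableS hi => //; apply: subset_itvl; by rewrite bnd_simp.
Qed.

Let sub_integrable h u v : mu.-integrable `[s, T] (EFin \o h) -> s <= u -> v <= T ->
  mu.-integrable `]u, v] (EFin \o h).
Proof.
move=> hi su vT; apply: integrableS hi => //.
by apply: subset_itv; rewrite bnd_simp.
Qed.

(** Near time t both partial i g (y r) and the slopes of g between y u and y v
are within eps / 2 of partial i g (y t). *)
Let local_bound (eps : R) t : 0 < eps -> s <= t <= T -> exists2 e : R, 0 < e &
  forall u v, s <= u -> u <= t -> t <= v -> v <= T -> t - e < u -> v < t + e ->
  `|g (y v) - g (y u) - (J f v - J f u)| <= eps * (J A v - J A u).
Proof.
move=> eps0 stT; pose eps' := eps / 2.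
have eps'0 : 0 < eps' by rewrite divr_gt0.
have Hi (i : 'I_n) : \forall x \near y t, `|partial i g x - c_ i t| <= eps'.
  have /cvgrPdist_le/(_ _ eps'0) : partial i g x @[x --> y t] --> c_ i t.
    exact: (Ck1_partial_continuous (k := 0)).
  by apply: filterS => x; rewrite distrC.
have := filter_forall (nbhs_filter _) Hi.
rewrite -nbhs_ballE => -[rho /= rho0 Hrho].
have : \forall r \near t, ball (y t) rho (y r) by apply: cy; exact: nbhsx_ballx.
move=> /nbhs_ballP[e /= e0 He].
exists e => // u v su ut tv vT teu vte.
have uv : u <= v by exact: le_trans tv.
have near_t r : u <= r <= v -> forall j, `|y r 0 j - y t 0 j| < rho.
  move=> /andP[ur rv] j.
  have [_ /(_ 0 j)] : ball (y t) rho (y r).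
    apply: He; rewrite /ball/= ltr_norml; apply/andP; split; lra.
  by rewrite /ball/= distrC.
have Hc i (x : 'rV[R]_n) : (forall j, `|x 0 j - y t 0 j| < rho) -> `|partial i g x - c_ i t| <= eps'.
  move=> Hx; apply: (Hrho x); split => // k j; rewrite (ord1 k) /ball/= distrC; exact: Hx.
have dg i (x : 'rV[R]_n) : derivable g x (delta_mx 0 i) by have [_ /(_ i)[]] := g1.
have nu : forall j, `|y u 0 j - y t 0 j| < rho by apply: near_t; rewrite lexx.
have nv : forall j, `|y v 0 j - y t 0 j| < rho by apply: near_t; rewrite lexx uv.
have := increment_le_partial dg Hc nu nv.
have yE i : y v 0 i - y u 0 i = \int[mu]_(r in `]u, v]) a i r.
  rewrite (ya i (t := v)) ?(le_trans su uv)// (ya i (t := u)) ?su ?(le_trans uv)//.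
  by rewrite opprD addrACA subrr add0r -JB.
under eq_bigr do rewrite yE.
under [X in _ <= _ * X -> _]eq_bigr do rewrite yE.
move=> H1.
have ai' i := sub_integrable (ai i) su vT.
have fi' := sub_integrable fi su vT.
have Ai' := sub_integrable Ai su vT.
have Zi i : mu.-integrable `]u, v] (EFin \o (fun r => c_ i t * a i r)).
  exact: real_integrableZ.
have nai' i := integrable_norm (ai' i).
have SA : \sum_i `|\int[mu]_(r in `]u, v]) a i r| <= \int[mu]_(r in `]u, v]) A r.
  rewrite Rintegral_sum//; apply: ler_sum => i _.
  exact: le_normr_Rintegral.
rewrite !JB//.
have E2 : \sum_i c_ i t * \int[mu]_(r in `]u, v]) a i r - \int[mu]_(r in `]u, v]) f r =
    \int[mu]_(r in `]u, v]) (\sum_i c_ i t * a i r - f r).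
  rewrite RintegralB//; last first.
    exact: real_integrable_sum.
  rewrite (Rintegral_sum _ _ Zi)//.
  by congr (_ - _); apply: eq_bigr => i _; rewrite RintegralZl.
have H2 : `|\sum_i c_ i t * \int[mu]_(r in `]u, v]) a i r - \int[mu]_(r in `]u, v]) f r|
   <= eps' * \int[mu]_(r in `]u, v]) A r.
  have i2 : mu.-integrable `]u, v] (EFin \o (fun r => \sum_i c_ i t * a i r - f r)).
    apply: real_integrableB => //.
    exact: real_integrable_sum.
  rewrite E2; apply: (le_trans (le_normr_Rintegral _ i2)) => //.
  rewrite -RintegralZl//; apply: le_Rintegral => //.
  - exact: integrable_norm.
  - exact: real_integrableZ.
  - move=> r /=; rewrite in_itv/= => /andP[ur rv].
    rewrite /f -sumrB mulr_sumr; apply: (le_trans (ler_norm_sum _ _ _)).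
    apply: ler_sum => i _; rewrite -mulrBl normrM ler_wpM2r//.
    by rewrite distrC; apply: Hc; apply: near_t; rewrite (ltW ur).
move: H1 H2 SA; rewrite /eps'.
set S1 := \sum_i c_ i t * _; set S2 := \sum_i `|_|; set I1 := \int[mu]_(r in _) f r.
set I2 := \int[mu]_(r in _) A r; set G := g (y v) - g (y u) => H1 H2 SA.
have -> : G - I1 = (G - S1) + (S1 - I1) by rewrite addrA subrK.
apply: (le_trans (ler_normD _ _)).
have H3 : eps / 2 * S2 <= eps / 2 * I2 by rewrite ler_wpM2l// ltW.
lra.
Qed.

(** The bound of the defect over ]u, v] by eps (J A v - J A u) is additive in the
interval, so interval induction carries it to [s, T]; then eps tends to 0. *)
Lemma chain_rule_integral :
  g (y T) = g (y s) + \int[mu]_(r in `[s, T]) \sum_i partial i g (y r) * a i r.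
Proof.
have Js h : J h s = 0 by rewrite /J set_itv1 Rintegral_set1.
have key (eps : R) : 0 < eps -> `|g (y T) - g (y s) - J f T| <= eps * J A T.
  move=> eps0.
  have := @interval_induction R s T (fun u v =>
    `|g (y v) - g (y u) - (J f v - J f u)| <= eps * (J A v - J A u)) sT.
  rewrite !Js !subr0; apply; last by move=> t; exact: local_bound.
  move=> u v w _ _ _ _ Huv Hvw.
  have -> : g (y w) - g (y u) - (J f w - J f u) =
    (g (y w) - g (y v) - (J f w - J f v)) + (g (y v) - g (y u) - (J f v - J f u)) by ring.
  have -> : eps * (J A w - J A u) = eps * (J A w - J A v) + eps * (J A v - J A u) by ring.
  by apply: (le_trans (ler_normD _ _)); exact: lerD.
have JA0 : 0 <= J A T.
  by apply: Rintegral_ge0 => r _; apply: sumr_ge0.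
suff : `|g (y T) - g (y s) - J f T| <= 0.
  by rewrite normr_le0 subr_eq0 subr_eq addrC => /eqP.
apply/ler_addgt0Pl => e e0; rewrite addr0.
apply: (le_trans (key (e / (J A T + 1)) _)); first by rewrite divr_gt0// ltr_wpDl.
rewrite mulrAC ler_pdivrMr ?ltr_wpDl// ler_wpM2l// ?ltW//.
by rewrite ltrDl.
Qed.

End ChainRule.

(** * C^k functions on R^d and their supports *)

Section CkCalculus.
Variables (R : realType) (n : nat).
Implicit Types (f g h : 'rV[R]_n -> R) (i j : 'I_n) (x : 'rV[R]_n).
Local Notation e_ i := (delta_mx 0 i : 'rV[R]_n).

Lemma Ck_derivable k h i x : Ck k.+1 h -> derivable h x (e_ i).
Proof. by move=> [_ /(_ i)[]]. Qed.

Lemma Ck_partial k h i : Ck k.+1 h -> Ck k (partial i h).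
Proof. by move=> [_ /(_ i)[]]. Qed.

Lemma CkW k h : Ck k.+1 h -> Ck k h.
Proof.
elim: k h => [|k IH] h; first by case.
move=> [hc hd]; split=> // i; have [d1 d2] := hd i; split=> //.
exact: IH.
Qed.

Lemma partialD f g i : (forall x, derivable f x (e_ i)) -> (forall x, derivable g x (e_ i)) ->
  partial i (fun x => f x + g x) = (fun x => partial i f x + partial i g x).
Proof. by move=> df dg; apply/funext => x; exact: (deriveD (df x) (dg x)). Qed.

Lemma partialB f g i : (forall x, derivable f x (e_ i)) -> (forall x, derivable g x (e_ i)) ->
  partial i (fun x => f x - g x) = (fun x => partial i f x - partial i g x).
Proof. by move=> df dg; apply/funext => x; exact: (deriveB (df x) (dg x)). Qed.

Lemma partialM f g i : (forall x, derivable f x (e_ i)) -> (forall x, derivable g x (e_ i)) ->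
  partial i (fun x => f x * g x) = (fun x => f x * partial i g x + g x * partial i f x).
Proof. by move=> df dg; apply/funext => x; exact: (deriveM (df x) (dg x)). Qed.

Lemma partialV f i : (forall x, f x != 0) -> (forall x, derivable f x (e_ i)) ->
  partial i (fun x => (f x)^-1) =
  (fun x => - ((f x)^-1 * (f x)^-1) * partial i f x).
Proof.
move=> f0 df; apply/funext => x; rewrite /partial deriveV//.
by rewrite expr2 invfM.
Qed.

Lemma partial_cst (c : R) i : partial i (fun=> c) = (fun=> 0).
Proof. by apply/funext => x; exact: derive_cst. Qed.

Lemma Ck_cst k (c : R) : Ck k (fun _ : 'rV[R]_n => c).
Proof.
elim: k c => [|k IH] c /=; first exact: cst_continuous.
split; first exact: cst_continuous.
by move=> i; split; [move=> x; exact: derivable_cst|rewrite partial_cst].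
Qed.

Lemma Ck_add k f g : Ck k f -> Ck k g -> Ck k (fun x => f x + g x).
Proof.
elim: k f g => [|k IH] f g.
  by move=> cf cg x; apply: continuousD; [exact: cf|exact: cg].
move=> [cf df] [cg dg]; split.
  by move=> x; apply: continuousD; [exact: cf|exact: cg].
move=> i; have [df1 df2] := df i; have [dg1 dg2] := dg i; split.
  by move=> x; apply: derivableD.
by rewrite partialD//; exact: IH.
Qed.

Lemma Ck_mul k f g : Ck k f -> Ck k g -> Ck k (fun x => f x * g x).
Proof.
elim: k f g => [|k IH] f g.
  by move=> cf cg x; apply: continuousM; [exact: cf|exact: cg].
move=> Cf Cg; have := Cf; have := Cg; move=> [cf df] [cg dg]; split.
  by move=> x; apply: continuousM; [exact: cg|exact: cf].
move=> i; have [df1 df2] := df i; have [dg1 dg2] := dg i; split.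
  by move=> x; apply: derivableM.
by rewrite partialM//; apply: Ck_add; apply: IH => //; exact: CkW.
Qed.

Lemma Ck_opp k f : Ck k f -> Ck k (fun x => - f x).
Proof.
move=> Cf; have -> : (fun x => - f x) = (fun x => -1 * f x).
  by apply/funext => x; rewrite mulN1r.
by apply: Ck_mul => //; exact: Ck_cst.
Qed.

Lemma Ck_sub k f g : Ck k f -> Ck k g -> Ck k (fun x => f x - g x).
Proof. by move=> Cf Cg; apply: Ck_add => //; exact: Ck_opp. Qed.

Lemma Ck_inv k f : (forall x, f x != 0) -> Ck k f -> Ck k (fun x => (f x)^-1).
Proof.
move=> f0; elim: k => [|k IH] Cf.
  by move=> x; exact: (cvgV (f0 x) (Cf x)).
have := Cf; move=> [cf df]; split.
  by move=> x; exact: (cvgV (f0 x) (cf x)).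
move=> i; have [df1 df2] := df i; split.
  by move=> x; apply: derivableV.
rewrite partialV//; apply: Ck_mul => //; apply: Ck_opp.
by apply: Ck_mul; apply: IH; exact: CkW.
Qed.

Lemma Ck_prod k (I : Type) (l : seq I) (f : I -> 'rV[R]_n -> R) :
  (forall a, Ck k (f a)) -> Ck k (fun x => \prod_(a <- l) f a x).
Proof.
move=> Cf; elim: l => [|a l IH].
  by under eq_fun do rewrite big_nil; exact: Ck_cst.
by under eq_fun do rewrite big_cons; exact: Ck_mul.
Qed.

(** Functions of one coordinate, composed with an affine map so that both ends of
an interval can be treated. *)
Lemma is_derive_coord_comp (phi : R -> R) (dphi c s : R) i j x :
  is_derive (c + s * x 0 i) 1 phi dphi ->
  is_derive x (e_ j) (fun y => phi (c + s * y 0 i)) ((j == i)%:R * s * dphi).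
Proof.
move=> [d1 d2].
have [->|ji] := eqVneq j i; last first.
  rewrite !mul0r; have E : (fun h : R => h^-1 *: (((fun y => phi (c + s * y 0 i)) \o shift x) (h *: e_ j) - phi (c + s * x 0 i))) = (fun=> 0).
    apply/funext => h /=; rewrite !mxE/= eq_sym (negbTE ji) mulr0 add0r.
    by rewrite subrr scaler0.
  split; first by rewrite /derivable E; exact: is_cvg_cst.
  by rewrite /derive E; exact: lim_cst.
have dv : is_derive (0 : R) 1 (fun t : R => phi (c + s * x 0 i + s * t)) (s * dphi).
  have H1 : is_derive (0 : R) 1 (fun t : R => c + s * x 0 i + s * t) s.
    have := is_deriveD (is_derive_cst (c + s * x 0 i) (0 : R) (1 : R))
      (is_deriveZ s (is_derive_id (0 : R) (1 : R))).
    by rewrite add0r /GRing.scale/= mulr1.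
  have H2 : is_derive (c + s * x 0 i + s * 0) 1 phi dphi.
    by rewrite mulr0 addr0; split.
  have := @is_derive1_comp R phi (fun t : R => c + s * x 0 i + s * t) 0 _ _ H2 H1.
  by rewrite [dphi * s]mulrC.
have E : (fun h : R => h^-1 *: (((fun y => phi (c + s * y 0 i)) \o shift x) (h *: e_ i) - phi (c + s * x 0 i))) =
  (fun h : R => h^-1 *: (((fun t : R => phi (c + s * x 0 i + s * t)) \o shift 0) (h *: 1) - phi (c + s * x 0 i + s * 0))).
  apply/funext => h /=; rewrite !mxE/= !eqxx/= mulr0 !addr0 /GRing.scale/= !mulr1.
  by congr (_ * (phi _ - _)); ring.
rewrite mul1r; case: dv => dv1 dv2.
by split; rewrite /derivable /derive E.
Qed.

Lemma is_derive_coord i j x :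
  is_derive x (e_ j) (fun x : 'rV[R]_n => x 0 i) (j == i)%:R.
Proof.
have := @is_derive_coord_comp id 1 0 1 i j x (is_derive_id _ _).
rewrite !mulr1.
by have -> : (fun y : 'rV[R]_n => id (0 + 1 * y 0 i)) = (fun y => y 0 i)
  by apply/funext => y; rewrite /= add0r mul1r.
Qed.

Lemma partial_coord i j :
  partial j (fun x : 'rV[R]_n => x 0 i) = (fun=> (j == i)%:R).
Proof. by apply/funext => x; have [_] := is_derive_coord i j x. Qed.

Lemma Ck_coord k i : Ck k (fun x : 'rV[R]_n => x 0 i).
Proof.
case: k => [|k] /=; first exact: coord_continuous.
split; first exact: coord_continuous.
move=> j; split; first by move=> x; have [] := is_derive_coord i j x.
by rewrite partial_coord; exact: Ck_cst.
Qed.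

Lemma zero_off_support h x : ~ closure [set y | h y != 0] x -> h x = 0.
Proof.
by move=> nx; apply/eqP/negPn/negP => hx; apply: nx; exact: subset_closure.
Qed.

Lemma partial_off_support h i x : ~ closure [set y | h y != 0] x -> partial i h x = 0.
Proof.
move=> nx; rewrite /partial.
have Hn : \near x, h x = cst 0 x.
  have : open_nbhs x (~` closure [set y | h y != 0]).
    by split=> //; apply: closed_openC; exact: closed_closure.
  move=> /open_nbhs_nbhs; apply: filterS => y ny; exact: zero_off_support.
by rewrite (near_eq_derive _ Hn) derive_cst.
Qed.

Lemma compactly_supported_sub f h :
  (forall x, ~ closure [set y | h y != 0] x -> f x = 0) ->
  compactly_supported h -> compactly_supported f.
Proof.
move=> fh cs; apply: (subclosed_compact _ cs); first exact: closed_closure.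
rewrite [X in _ `<=` X](closure_id _).1; last exact: closed_closure.
apply: closure_subset => x /= fx; apply: contrapT => /fh /eqP.
by rewrite (negbTE fx).
Qed.

Lemma partial_compactly_supported h i :
  compactly_supported h -> compactly_supported (partial i h).
Proof. by apply: compactly_supported_sub => x; exact: partial_off_support. Qed.

Lemma compactly_supported_in_box h : compactly_supported h ->
  exists2 a : R, 0 < a & forall x, h x != 0 -> forall i, `|x 0 i| <= a.
Proof.
move=> /compact_bounded[M [_ HM]]; exists (`|M| + 1); first by rewrite ltr_wpDl.
move=> x hx i.
have : `|x| <= `|M| + 1.
  apply: HM; last exact: subset_closure.
  by rewrite (le_lt_trans (ler_norm _))// ltrDl.
apply: le_trans; rewrite /Num.norm/= mx_normrE.
by apply: (le_bigmax _ (fun ij : 'I_1 * 'I_n => `|x ij.1 ij.2|) (0, i)).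
Qed.

Lemma box_compactly_supported h (L : R) :
  (forall x i, L < `|x 0 i| -> h x = 0) ->
  compactly_supported h /\
  (forall x i, L < `|x 0 i| -> ~ closure [set y | h y != 0] x).
Proof.
move=> hL.
pose B := [set x : 'rV[R]_n | forall i, `|x 0 i| <= L].
have clB : closed B.
  have -> : B = \bigcap_(i in [set: 'I_n]) ((fun x : 'rV[R]_n => `|x 0 i|) @^-1` `]-oo, L]).
    apply/seteqP; split => x /=.
      by move=> Bx i _ /=; rewrite in_itv/=; exact: Bx.
    by move=> Bx i; have := Bx i I; rewrite /= in_itv.
  apply: closed_bigI => i _; apply: closed_comp; last exact: interval_closed.
  move=> x _; apply: continuous_comp; first exact: coord_continuous.
  exact: norm_continuous.
have sB : [set y | h y != 0] `<=` B.
  move=> x /= hx i; rewrite leNgt; apply/negP => /hL /eqP.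
  by rewrite (negbTE hx).
have csB : closure [set y | h y != 0] `<=` B.
  by rewrite [X in _ `<=` X](closure_id _).1//; exact: closure_subset.
split; last by move=> x i xL /csB /(_ i); rewrite leNgt xL.
apply: (subclosed_compact _ _ csB); first exact: closed_closure.
apply: bounded_closed_compact => //.
exists `|L|; split; first exact: num_real.
move=> M LM x Bx; rewrite /Num.norm/= mx_normrE; apply: bigmax_le.
  by apply: ltW; apply: le_lt_trans LM.
move=> [k i] _ /=; rewrite (ord1 k); apply: (le_trans (Bx i)).
by rewrite (le_trans (ler_norm _))// ltW.
Qed.

(** Heine-Cantor on the support; two points outside the support have the same
image. *)
Lemma compactly_supported_unif f (eps : R) : continuous f -> compactly_supported f ->
  0 < eps -> exists2 delta : R, 0 < delta &
    forall (z x : 'rV[R]_n), (forall i, `|z 0 i - x 0 i| < delta) -> `|f z - f x| <= eps.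
Proof.
move=> fc fs eps0.
pose P (delta : R) x := forall z : 'rV[R]_n, (forall i, `|z 0 i - x 0 i| < delta) -> `|f z - f x| <= eps.
have [delta [d0 Pd]] : exists delta : R, 0 < delta /\ (closure [set y | f y != 0]) `<=` P delta.
  have /compact_near_coveringP/(_ _ (0 : R)^'+ P _) := fs.
  have H x : closure [set y | f y != 0] x ->
      \forall x' \near x & delta \near (0 : R)^'+, P delta x'.
    move=> _.
    have e20 : 0 < eps / 2 by rewrite divr_gt0.
    have /cvgrPdist_le/(_ _ e20) : f y @[y --> x] --> f x by exact: fc.
    rewrite -nbhs_ballE => -[rho /= rho0 Hrho].
    exists (ball x (rho / 2), [set d | d < rho / 2]).
      split; first by apply: nbhsx_ballx; rewrite divr_gt0.
      by apply: nbhs_right_lt; rewrite divr_gt0.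
    move=> [x' delta] /= [[_ xx'] dr] z zx'.
    have h1 : `|f x - f x'| <= eps / 2.
      apply: Hrho; split=> // k i; rewrite (ord1 k); apply: lt_trans (xx' 0 i) _.
      by lra.
    have h2 : `|f x - f z| <= eps / 2.
      apply: Hrho; split=> // k i; rewrite (ord1 k) /ball/=.
      have := xx' 0 i; have := zx' i; rewrite /ball/= => a1 a2.
      have -> : x 0 i - z 0 i = (x 0 i - x' 0 i) - (z 0 i - x' 0 i) by ring.
      by apply: (le_lt_trans (ler_normB _ _)); lra.
    have -> : f z - f x' = (f x - f x') - (f x - f z) by ring.
    by apply: (le_trans (ler_normB _ _)); lra.
  move=> /(_ H) Hn.
  have /filter_ex [delta [d0 d1]] : \forall delta \near (0 : R)^'+, 0 < delta /\ (closure [set y | f y != 0]) `<=` P delta.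
    near=> delta; split; first by near: delta; exact: nbhs_right_gt.
    by near: delta; exact: Hn.
  by exists delta.
exists delta => // z x zx.
have [cx|cx] := pselect (closure [set y | f y != 0] x); first exact: Pd.
have [cz|cz] := pselect (closure [set y | f y != 0] z).
  rewrite distrC; apply: Pd => // i; rewrite distrC; exact: zx.
by rewrite !zero_off_support// subrr normr0 ltW.
Unshelve. all: by end_near. Qed.

End CkCalculus.

(** * Smooth cutoff functions *)

Section FlatFunction.
Variable R : realType.

(** u^(-k) exp(-1/u), extended by 0.  The powers are there because the family is
stable under differentiation: flat k is a combination of flat (k + 1) and
flat (k + 2) once differentiated. *)
Definition flat (k : nat) (u : R) : R :=
  if 0 < u then u^-1 ^+ k * expR (- u^-1) else 0.

Lemma flat_pos k u : 0 < u -> flat k u = u^-1 ^+ k * expR (- u^-1).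
Proof. by rewrite /flat => ->. Qed.

Lemma flat_npos k u : u <= 0 -> flat k u = 0.
Proof. by rewrite /flat ltNge => ->. Qed.

Lemma flat_ge0 k u : 0 <= flat k u.
Proof.
rewrite /flat; case: ifP => // u0.
by rewrite mulr_ge0 ?expR_ge0// exprn_ge0// invr_ge0 ltW.
Qed.

Lemma flat_gt0 k u : 0 < u -> 0 < flat k u.
Proof. by move=> u0; rewrite flat_pos// mulr_gt0 ?expR_gt0// exprn_gt0// invr_gt0. Qed.

(** Flatness at 0 to second order gives continuity and a null derivative there; it
comes from w^(k + 2) <= (k + 2)! exp w with w = 1 / u. *)
Lemma flat_le_sqr k u : flat k u <= k.+2`!%:R * u ^+ 2.
Proof.
have [u0|u0] := leP u 0; first by rewrite flat_npos// mulr_ge0 ?sqr_ge0.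
have [w w0 uE] : exists2 w : R, 0 < w & u = w^-1.
  by exists u^-1; rewrite ?invr_gt0// invrK.
rewrite flat_pos// uE invrK.
have H : w ^+ k.+2 <= k.+2`!%:R * expR w.
  rewrite -ler_pdivrMl ?ltr0n ?fact_gt0// mulrC.
  apply: (@le_trans _ _ (1 + w ^+ k.+2 / k.+2`!%:R)); first by rewrite lerDr.
  exact: (expR_ge1Dxn _ (ltW w0)).
rewrite exprVn ler_pdivlMr ?exprn_gt0// expRN.
rewrite mulrAC ler_pdivrMr ?expR_gt0//.
by rewrite -exprD addn2.
Qed.

Lemma is_derive_flat k (u : R) :
  is_derive u 1 (flat k) (- k%:R * flat k.+1 u + flat k.+2 u).
Proof.
have [u0|u0|->] := ltrgtP u 0.
- rewrite !flat_npos ?ltW// mulr0 addr0.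
  apply: (@near_eq_is_derive _ _ _ (cst 0)).
    by near=> v; rewrite flat_npos// ltW//; near: v; exact: lt_nbhsl.
- rewrite !flat_pos//.
  apply: (@near_eq_is_derive _ _ _ (fun v : R => v^-1 ^+ k * expR (- v^-1))). 
    near=> v; rewrite flat_pos//; near: v; exact: lt_nbhsr.
  have dV : is_derive u 1 (fun v : R => v^-1) (- u ^- 2).
    have -> : - u ^- 2 = - u ^- 2 *: (1 : R) by rewrite /GRing.scale/= mulr1.
    by apply: is_deriveV => //; rewrite gt_eqF.
  have dN : is_derive u 1 (fun v : R => - v^-1) (u ^- 2).
    by rewrite -[u ^- 2]opprK; exact: (is_deriveN dV).
  have dE : is_derive u 1 (fun v : R => expR (- v^-1)) (expR (- u^-1) * u ^- 2).
    exact: (@is_derive1_comp R expR (fun v => - v^-1) u _ _ (is_derive_expR _) dN).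
  have dX : is_derive u 1 (fun v : R => v^-1 ^+ k)
      ((k%:R * u^-1 ^+ k.-1) *: (- u ^- 2)).
    by have := is_deriveX k dV; rewrite exprfctE.
  apply: (is_derive_eq (is_deriveM dX dE)).
  rewrite /GRing.scale/= -exprVn.
  move: (expR (- u^-1)) => E; move: (u^-1) => w; case: k dX => [|k] _ /=.
    by rewrite expr0 mul1r !mul0r mulr0 addr0 oppr0 mul0r add0r mulrC.
  by rewrite !exprS; move: (k.+1%:R : R) (w ^+ k) => c p; ring.
- rewrite !flat_npos// mulr0 addr0.
  have H : (fun h : R => h^-1 *: ((flat k \o shift 0) (h *: 1) - flat k 0)) @ 0^' --> (0 : R).
    apply/cvgr0Pnorm_le => e e0.
    pose C := k.+2`!%:R : R.
    have C0 : 0 < C by rewrite ltr0n fact_gt0.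
    near=> h.
    rewrite /= addr0 (flat_npos k (lexx 0)) subr0 /GRing.scale/= mulr1.
    rewrite normrM normfV ler_pdivrMl; last by rewrite normr_gt0; near: h; exact: nbhs_dnbhs_neq.
    rewrite ger0_norm ?flat_ge0//; apply: (le_trans (flat_le_sqr _ _)).
    rewrite -/C -real_normK ?num_real// expr2 mulrCA ler_wpM2l//.
    rewrite -ler_pdivlMl//.
    near: h; apply: dnbhs0_le; by rewrite mulr_gt0 ?invr_gt0.
  split; first by apply/cvg_ex; exists 0.
  exact/cvg_lim.
Unshelve. all: by end_near. Qed.

Lemma Ck_flat (n : nat) m k (c s : R) (i : 'I_n) :
  Ck m (fun x : 'rV[R]_n => flat k (c + s * x 0 i)).
Proof.
elim: m k => [|m IH] k.
  move=> x; apply: (@continuous_comp _ _ _ (fun x : 'rV[R]_n => c + s * x 0 i)).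
    apply: continuousD; first exact: cst_continuous.
    by apply: continuousM; [exact: cst_continuous|exact: coord_continuous].
  by apply/differentiable_continuous/derivable1_diffP; have [] := is_derive_flat k (c + s * x 0 i).
have D (j : 'I_n) (x : 'rV[R]_n) :=
  is_derive_coord_comp j (is_derive_flat k (c + s * x 0 i)).
split; first by move=> x; have := IH k; move=> /Ck_continuous; exact.
move=> j; split; first by move=> x; have [] := D j x.
have -> : partial j (fun x : 'rV[R]_n => flat k (c + s * x 0 i)) =
  fun x => ((j == i)%:R * s) * (- k%:R * flat k.+1 (c + s * x 0 i) + flat k.+2 (c + s * x 0 i)).
  by apply/funext => x; have [_] := D j x.
apply: Ck_mul; first exact: Ck_cst.
by apply: Ck_add => //; apply: Ck_mul => //; exact: Ck_cst.
Qed.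

End FlatFunction.

Section Cutoff.
Variables (R : realType) (n : nat).

Definition smooth_step (u : R) : R := flat 0 u / (flat 0 u + flat 0 (1 - u)).

Lemma smooth_step_den (u : R) : flat 0 u + flat 0 (1 - u) != 0.
Proof.
rewrite gt_eqF//; have [u0|u0] := leP u 0.
  by rewrite ltr_wpDl ?flat_ge0// flat_gt0//; lra.
by rewrite ltr_pwDl ?flat_ge0// flat_gt0.
Qed.

Lemma smooth_step0 (u : R) : u <= 0 -> smooth_step u = 0.
Proof. by move=> u0; rewrite /smooth_step flat_npos// mul0r. Qed.

Lemma smooth_step1 (u : R) : 1 <= u -> smooth_step u = 1.
Proof.
move=> u1; rewrite /smooth_step (flat_npos 0 (u := 1 - u)) ?subr_le0// addr0 divff//.
by rewrite gt_eqF// flat_gt0//; lra.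
Qed.

Definition cutoff (a : R) (x : 'rV[R]_n) : R :=
  \prod_(i <- enum 'I_n) (smooth_step (a + 1 + (-1) * x 0 i) * smooth_step (a + 1 + 1 * x 0 i)).

Lemma Ck_smooth_step m (c s : R) (i : 'I_n) :
  Ck m (fun x : 'rV[R]_n => smooth_step (c + s * x 0 i)).
Proof.
apply: Ck_mul; first exact: Ck_flat.
apply: Ck_inv; first by move=> x; exact: smooth_step_den.
apply: Ck_add; first exact: Ck_flat.
have -> : (fun x : 'rV[R]_n => flat 0 (1 - (c + s * x 0 i))) =
  (fun x => flat 0 ((1 - c) + (- s) * x 0 i)).
  by apply/funext => x; congr flat; ring.
exact: Ck_flat.
Qed.

Lemma Ck_cutoff m a : Ck m (cutoff a).
Proof.
apply: (Ck_prod _ (f := fun i x => smooth_step (a + 1 + (-1) * x 0 i) *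
  smooth_step (a + 1 + 1 * x 0 i))) => i.
by apply: Ck_mul; exact: Ck_smooth_step.
Qed.

Lemma cutoff1 a (x : 'rV[R]_n) : (forall i, `|x 0 i| <= a) -> cutoff a x = 1.
Proof.
move=> xa; rewrite /cutoff big1_seq// => i _.
have := xa i; rewrite ler_norml => /andP[h1 h2].
by rewrite !smooth_step1 ?mulr1//; lra.
Qed.

Lemma cutoff0 a (x : 'rV[R]_n) i : a + 1 < `|x 0 i| -> cutoff a x = 0.
Proof.
move=> ax; apply/eqP; rewrite /cutoff prodf_seq_eq0; apply/hasP; exists i.
  by rewrite mem_enum.
rewrite /= mulf_eq0; have [x0|x0] := leP 0 (x 0 i).
  by rewrite smooth_step0 ?eqxx//; move: ax; rewrite ger0_norm//; lra.
by rewrite [X in _ || (X == 0)]smooth_step0 ?eqxx ?orbT//; move: ax; rewrite ltr0_norm//; lra.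
Qed.

End Cutoff.

(** * Bernstein polynomials *)

Section Bernstein.
Variables (R : realType) (n : nat) (L : R).
Hypothesis L0 : 0 < L.
Implicit Types (f g : 'rV[R]_n -> R) (i j : 'I_n) (l : seq 'I_n) (x z : 'rV[R]_n).
Local Notation e_ i := (delta_mx 0 i : 'rV[R]_n).

(** Affine map of [-L, L] onto [0, 1]. *)
Definition bweight (x : 'rV[R]_n) (i : 'I_n) : R := (x 0 i + L) * (2 * L)^-1.

(** The expectation of f at the end of a random walk that starts at (-L, ..., -L)
and has one independent step for each entry i of l, of length eta in direction i,
taken with probability bweight x i.  When every coordinate occurs N times in l and
eta = 2 L / N, this is the N-th Bernstein polynomial of f on the box [-L, L]^d.
Recursion on the list of steps replaces manipulations of binomial sums. *)
Fixpoint bern (eta : R) (l : seq 'I_n) (f : 'rV[R]_n -> R) (x : 'rV[R]_n) : R :=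
  if l is i :: l' then
    (1 - bweight x i) * bern eta l' f x
    + bweight x i * bern eta l' (fun z => f (z + eta *: delta_mx 0 i)) x
  else f (const_mx (- L)).

Definition fdiff (eta : R) (i : 'I_n) (f : 'rV[R]_n -> R) (z : 'rV[R]_n) : R :=
  f (z + eta *: delta_mx 0 i) - f z.

Variable eta : R.

Lemma bern_lin l f g (a c : R) x :
  bern eta l (fun z => a * f z + c * g z) x = a * bern eta l f x + c * bern eta l g x.
Proof. by elim: l f g => [//|i l IH] f g /=; rewrite !IH; ring. Qed.

Lemma bern_cst l (c : R) x : bern eta l (fun=> c) x = c.
Proof. by elim: l => [//|i l IH] /=; rewrite !IH; ring. Qed.

Lemma bernZ l f (a : R) x : bern eta l (fun z => a * f z) x = a * bern eta l f x.
Proof.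
have -> : (fun z => a * f z) = (fun z => a * f z + 0 * f z).
  by apply/funext => z; rewrite mul0r addr0.
by rewrite bern_lin mul0r addr0.
Qed.

Lemma bernB l f g x : bern eta l (fun z => f z - g z) x = bern eta l f x - bern eta l g x.
Proof.
have -> : (fun z => f z - g z) = (fun z => 1 * f z + (-1) * g z).
  by apply/funext => z; rewrite mul1r mulN1r.
by rewrite bern_lin mul1r mulN1r.
Qed.

Lemma bernD l f g x : bern eta l (fun z => f z + g z) x = bern eta l f x + bern eta l g x.
Proof.
have -> : (fun z => f z + g z) = (fun z => 1 * f z + 1 * g z).
  by apply/funext => z; rewrite !mul1r.
by rewrite bern_lin !mul1r.
Qed.

Lemma bern_sum l (I : Type) (r : seq I) (F : I -> 'rV[R]_n -> R) x :
  bern eta l (fun z => \sum_(a <- r) F a z) x = \sum_(a <- r) bern eta l (F a) x.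
Proof.
elim: r => [|a r IH].
  by rewrite big_nil -[RHS](bern_cst l 0 x); congr bern; apply/funext => z; rewrite big_nil.
rewrite big_cons -IH -bernD; congr bern; apply/funext => z; rewrite big_cons//.
Qed.

Definition in_box x := forall i, `|x 0 i| <= L.

Lemma bweight01 x i : in_box x -> 0 <= bweight x i <= 1.
Proof.
move=> /(_ i); rewrite ler_norml => /andP[h1 h2]; rewrite /bweight.
have L2 : 0 < 2 * L by rewrite mulr_gt0.
rewrite ler_pdivrMr// mul1r mulr_ge0/= ?invr_ge0 ?(ltW L2)//; lra.
Qed.

Lemma bern_le l f g x : in_box x -> (forall z, f z <= g z) -> bern eta l f x <= bern eta l g x.
Proof.
move=> xb; elim: l f g => [|i l IH] f g fg /=; first exact: fg.
have /andP[t0 t1] := bweight01 i xb.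
by apply: lerD; apply: ler_wpM2l; rewrite ?subr_ge0//; apply: IH.
Qed.

Lemma bern_dist l f x (c : R) : in_box x ->
  `|bern eta l f x - c| <= bern eta l (fun z => `|f z - c|) x.
Proof.
move=> xb; rewrite -[X in bern eta l f x - X](bern_cst l c x) -bernB.
rewrite ler_norml; apply/andP; split; last by apply: bern_le => // z; exact: ler_norm.
rewrite -mulN1r -bernZ; apply: bern_le => // z; rewrite mulN1r lerNl.
by rewrite -normrN; exact: ler_norm.
Qed.

(** Variance plus squared bias of the i-th coordinate of the walk. *)
Lemma bern_moment l x i (c : R) :
  bern eta l (fun z => (z 0 i - c) ^+ 2) x =
  (count_mem i l)%:R * eta ^+ 2 * bweight x i * (1 - bweight x i) +
  (- L + (count_mem i l)%:R * eta * bweight x i - c) ^+ 2.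
Proof.
elim: l c => [|j l IH] c /=.
  by rewrite !mxE !mul0r add0r addr0.
rewrite IH; have [->|ji] := eqVneq j i.
  have -> : (fun z => ((z + eta *: e_ i) 0 i - c) ^+ 2) = (fun z => (z 0 i - (c - eta)) ^+ 2).
    by apply/funext => z; rewrite !mxE !eqxx mulr1; ring.
  rewrite IH natrD (_ : true%:R = 1 :> R)//; ring.
have -> : (fun z => ((z + eta *: e_ j) 0 i - c) ^+ 2) = (fun z => (z 0 i - c) ^+ 2).
  by apply/funext => z; rewrite !mxE [i == j]eq_sym (negbTE ji) mulr0 addr0.
by rewrite IH add0n; ring.
Qed.

Lemma bern_swap i j l f x : bern eta (i :: j :: l) f x = bern eta (j :: i :: l) f x.
Proof.
rewrite /=; have -> : (fun z => f (z + eta *: e_ j + eta *: e_ i)) =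
  (fun z => f (z + eta *: e_ i + eta *: e_ j)) by apply/funext => z; rewrite addrAC.
ring.
Qed.

Lemma bern_rem j l f x : j \in l -> bern eta (j :: rem j l) f x = bern eta l f x.
Proof.
elim: l f => [//|i l IH] f.
rewrite inE /=; have [->|ij] := eqVneq i j; first by [].
move=> /= jl.
by rewrite -/(bern eta (j :: i :: rem j l) f x) bern_swap /= -!IH.
Qed.

Lemma Ck_bweight k i : Ck k (fun x => bweight x i).
Proof.
apply: Ck_mul; last exact: Ck_cst.
by apply: Ck_add; [exact: Ck_coord|exact: Ck_cst].
Qed.

Lemma Ck_bern k l f : Ck k (bern eta l f).
Proof.
elim: l f => [|i l IH] f; first exact: Ck_cst.
apply: Ck_add; apply: Ck_mul => //; last exact: Ck_bweight.
by apply: Ck_sub; [exact: Ck_cst|exact: Ck_bweight].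
Qed.

Lemma partial_bweight j i :
  partial j (fun x => bweight x i) = (fun=> (j == i)%:R * (2 * L)^-1).
Proof.
apply/funext => x.
have := @is_derive_coord_comp R n id 1 (L * (2 * L)^-1) (2 * L)^-1 i j x (is_derive_id _ _).
rewrite mulr1 => -[_ <-]; congr ('D_ _ _ _); apply/funext => y.
by rewrite /bweight/=; ring.
Qed.

(** Differentiating the probability of one step replaces f by its increment along
that step and removes the step; all steps in direction j contribute equally. *)
Lemma partial_bern j l f :
  partial j (bern eta l f) = (fun x => (count_mem j l)%:R * (2 * L)^-1 *
    bern eta (rem j l) (fdiff eta j f) x).
Proof.
elim: l f => [|i l IH] f.
  by rewrite /= (partial_cst _ j); apply/funext => x; rewrite !mul0r.
have dB l' f' x : derivable (bern eta l' f') x (e_ j) by exact: (Ck_derivable (Ck_bern 1 _ _)).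
have dw x : derivable (fun x => bweight x i) x (e_ j) by exact: (Ck_derivable (Ck_bweight 1 _)).
have dw' x : derivable (fun x => 1 - bweight x i) x (e_ j).
  by apply: (@Ck_derivable _ _ 0); apply: Ck_sub; [exact: Ck_cst|exact: Ck_bweight].
have E : partial j (bern eta (i :: l) f) = fun x =>
   ((1 - bweight x i) * partial j (bern eta l f) x + bern eta l f x * (- ((j == i)%:R * (2 * L)^-1))) +
   (bweight x i * partial j (bern eta l (fun z => f (z + eta *: e_ i))) x
     + bern eta l (fun z => f (z + eta *: e_ i)) x * ((j == i)%:R * (2 * L)^-1)).
  rewrite /= partialD; last 2 first.
  - by move=> x; apply: derivableM.
  - by move=> x; apply: derivableM.
  have d1 x : derivable (fun _ : 'rV[R]_n => 1 : R) x (e_ j) by exact: derivable_cst.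
  rewrite (partialM dw' (dB l f)) (partialM dw (dB l _)) (partialB d1 dw).
  by rewrite partial_cst partial_bweight; apply/funext => x; rewrite sub0r.
rewrite E !IH; apply/funext => x; rewrite /= [i == j]eq_sym.
set c := (count_mem j l)%:R; set k := (2 * L)^-1.
have [ji|ji] := eqVneq j i; last first.
  rewrite !mul0r oppr0 !mulr0 !addr0 add0n /=.
  have -> : fdiff eta j (fun z => f (z + eta *: e_ i)) = (fun z => fdiff eta j f (z + eta *: e_ i)).
    by apply/funext => z; rewrite /fdiff addrAC.
  ring.
rewrite -ji in E *.
have D : bern eta l (fun z => f (z + eta *: e_ j)) x - bern eta l f x =
    bern eta l (fdiff eta j f) x by rewrite -bernB.
(* If j does not occur in l, both sides vanish because c = 0. *)
have cE : c * bern eta l (fdiff eta j f) x =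
    c * ((1 - bweight x j) * bern eta (rem j l) (fdiff eta j f) x +
      bweight x j * bern eta (rem j l) (fdiff eta j (fun z => f (z + eta *: e_ j))) x).
  have [jl|jl] := boolP (j \in l); first by rewrite -(bern_rem _ _ jl).
  by rewrite /c (count_memPn jl) !mul0r.
rewrite natrD -/c (_ : true%:R = 1 :> R)//.
transitivity (k * bern eta l (fdiff eta j f) x + k * (c * bern eta l (fdiff eta j f) x)); last by ring.
rewrite cE -D; ring.
Qed.

(** Chebyshev's argument: |f z - f x| is at most eps when z is delta-close to x, and
at most 2 M |z - x|^2 / delta^2 otherwise.  The number of steps in each direction
is allowed to fall short of N by 2, as happens after two differentiations. *)
Lemma bern_approx f (M eps delta : R) (N : nat) l x :
  (0 < N)%N -> eta = 2 * L / N%:R -> 0 < delta -> 0 <= eps ->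
  (forall z, `|f z| <= M) ->
  (forall z y : 'rV[R]_n, (forall i, `|z 0 i - y 0 i| < delta) -> `|f z - f y| <= eps) ->
  (forall i, (count_mem i l <= N <= (count_mem i l).+2)%N) -> in_box x ->
  `|bern eta l f x - f x| <= eps + 2 * M / delta ^+ 2 * (n%:R * (20 * L ^+ 2)) / N%:R.
Proof.
move=> N0 etaE d0 e0 fM fmod lN xb; apply: (le_trans (bern_dist _ _ _ xb)).
have N0R : 0 < N%:R :> R by rewrite ltr0n.
have M0 : 0 <= M by apply: le_trans (fM 0).
have C0 : 0 <= 2 * M / delta ^+ 2 by rewrite divr_ge0 ?sqr_ge0// mulr_ge0.
have step1 z : `|f z - f x| <= 1 * (eps) + 2 * M / delta ^+ 2 * \sum_i (z 0 i - x 0 i) ^+ 2.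
  have S0 : 0 <= \sum_i (z 0 i - x 0 i) ^+ 2 by apply: sumr_ge0 => i _; exact: sqr_ge0.
  have [zx|zx] := pselect (forall i, `|z 0 i - x 0 i| < delta).
    by rewrite mul1r (le_trans (fmod _ _ zx))// lerDl mulr_ge0.
  have [i zxi] : exists i, delta <= `|z 0 i - x 0 i|.
    apply: contrapT => H; apply: zx => i; rewrite ltNge; apply/negP => Hi.
    by apply: H; exists i.
  have h1 : delta ^+ 2 <= \sum_i (z 0 i - x 0 i) ^+ 2.
    rewrite (bigD1 i)//= -[delta ^+ 2]addr0; apply: lerD; last first.
      by apply: sumr_ge0 => j _; exact: sqr_ge0.
    by rewrite -[X in _ <= X]real_normK ?num_real// lerXn2r ?nnegrE ?(ltW d0).
  have h2 : 2 * M <= 2 * M / delta ^+ 2 * \sum_i (z 0 i - x 0 i) ^+ 2.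
    rewrite -[leLHS](divfK (lt0r_neq0 (exprn_gt0 2 d0))); exact: ler_wpM2l.
  apply: (le_trans (ler_normB _ _)); have := fM z; have := fM x; lra.
apply: (le_trans (bern_le _ xb step1)).
rewrite bern_lin bern_cst bern_sum mul1r lerD2l -[leRHS]mulrA ler_wpM2l//.
rewrite -mulrA -[n in n%:R]card_ord -sum1_card natr_sum mulr_suml; apply: ler_sum => i _.
rewrite mul1r bern_moment.
have /andP[t0 t1] := bweight01 i xb.
have xE : x 0 i = N%:R * eta * bweight x i - L.
  rewrite etaE /bweight; field; rewrite !(gt_eqF N0R, gt_eqF L0)//.
have /andP[kN Nk] := lN i.
set w := bweight x i in t0 t1 xE *; set k := (count_mem i l)%:R : R.
have k0 : 0 <= k by rewrite ler0n.
have kN' : k <= N%:R by rewrite ler_nat.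
have Nk' : N%:R <= k + 2 by rewrite -natrD ler_nat addn2.
(* The walk with N steps is centred at x; missing steps shift it by eta w each. *)
have -> : (- L + k * eta * w - x 0 i) = (k - N%:R) * (eta * w) by rewrite xE; ring.
have e2 : 0 <= eta ^+ 2 by exact: sqr_ge0.
have N1 : 1 <= N%:R :> R by rewrite ler1n.
have h1 : k * eta ^+ 2 * w * (1 - w) <= N%:R * eta ^+ 2.
  rewrite -mulrA; apply: (le_trans (y := k * eta ^+ 2 * 1)).
    by apply: ler_wpM2l; [rewrite mulr_ge0|nra].
  by rewrite mulr1 ler_wpM2r.
have h2 : ((k - N%:R) * (eta * w)) ^+ 2 <= 4 * eta ^+ 2.
  rewrite exprMn [(eta * w) ^+ 2]exprMn; apply: ler_pM.
  - exact: sqr_ge0.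
  - by rewrite mulr_ge0// sqr_ge0.
  - have h : 0 <= (N%:R - k) * (2 - (N%:R - k)).
      by apply: mulr_ge0; rewrite subr_ge0// lerBlDl.
    have -> : (k - N%:R) ^+ 2 = 2 * (N%:R - k) - (N%:R - k) * (2 - (N%:R - k)) by ring.
    lra.
  - by rewrite -[leRHS]mulr1 ler_wpM2l// expr_le1.
have -> : 20 * L ^+ 2 / N%:R = 5 * N%:R * eta ^+ 2.
  by rewrite etaE; field; rewrite gt_eqF.
apply: (le_trans (lerD h1 h2)); nra.
Qed.

End Bernstein.

(** * Polynomial approximation up to second derivatives *)

Section Density.
Variables (R : realType) (n : nat).
Implicit Types (f g h : 'rV[R]_n -> R) (i j : 'I_n) (x z : 'rV[R]_n).
Local Notation e_ i := (delta_mx 0 i : 'rV[R]_n).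

Lemma norm_mul_bool (u : R) (c : bool) : `|u * c%:R| <= `|u|.
Proof. by rewrite normrM normr_nat -[leRHS]mulr1 ler_wpM2l// lern1 leq_b1. Qed.

Lemma partial_shift h i (v x : 'rV[R]_n) :
  derivable h (x + v) (e_ i) ->
  derivable (fun z => h (z + v)) x (e_ i) /\
  partial i (fun z => h (z + v)) x = partial i h (x + v).
Proof.
move=> dh.
have E : (fun t : R => t^-1 *: (((fun z => h (z + v)) \o shift x) (t *: e_ i) - h (x + v))) =
  (fun t : R => t^-1 *: ((h \o shift (x + v)) (t *: e_ i) - h (x + v))).
  by apply/funext => t /=; rewrite addrA.
by split; rewrite /derivable /partial /derive E.
Qed.

Lemma fdiff_partial1 h i (eta delta eps : R) z : 0 < eta < delta ->
  (forall x, derivable h x (e_ i)) ->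
  (forall (z y : 'rV[R]_n), (forall j, `|z 0 j - y 0 j| < delta) ->
    `|partial i h z - partial i h y| <= eps) ->
  `|eta^-1 * fdiff eta i h z - partial i h z| <= eps.
Proof.
move=> /andP[e0 ed] dh hmod.
have := @line_increment R n h z i eta (partial i h z) eps dh.
rewrite (gtr0_norm e0) => H.
have {}H : `|fdiff eta i h z - partial i h z * eta| <= eps * eta.
  apply: H => u ue _; apply: hmod => j; rewrite !mxE [z 0 j + _]addrC addrK.
  apply: (le_lt_trans _ ed); apply: le_trans ue.
  exact: norm_mul_bool.
have -> : eta^-1 * fdiff eta i h z - partial i h z =
  eta^-1 * (fdiff eta i h z - partial i h z * eta).
  by field; rewrite gt_eqF.
by rewrite normrM gtr0_norm ?invr_gt0// ler_pdivrMl// [eta * eps]mulrC.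
Qed.

(** The mean value theorem is applied in direction j to the increment of h in
direction i, then in direction i to partial j h.  The order matters: this one produces
partial i (partial j h), the other one partial j (partial i h). *)
Lemma fdiff_partial2 h i j (eta delta eps : R) z : 0 < eta < delta ->
  Ck 2 h ->
  (forall (z y : 'rV[R]_n), (forall k, `|z 0 k - y 0 k| < delta + delta) ->
    `|partial i (partial j h) z - partial i (partial j h) y| <= eps) ->
  `|eta^-1 ^+ 2 * fdiff eta i (fdiff eta j h) z - partial i (partial j h) z| <= eps.
Proof.
move=> /andP[e0 ed] h2 hmod.
have dh k x : derivable h x (e_ k) by exact: (Ck_derivable h2).
have dhj x : derivable (partial j h) x (e_ i) by exact: (Ck_derivable (Ck_partial j h2)).
set c := partial i (partial j h) z.
pose G := fdiff eta i h.
have dS x : derivable (fun z => h (z + eta *: e_ i)) x (e_ j) by have [] := partial_shift (dh j (x + eta *: e_ i)).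
have dG x : derivable G x (e_ j) by apply: derivableB.
have pG x : partial j G x = partial j h (x + eta *: e_ i) - partial j h x.
  by rewrite /G/fdiff (partialB dS (dh j)); have [_ ->] := partial_shift (dh j (x + eta *: e_ i)).
have small (u : R) (k l : 'I_n) : `|u| <= eta -> `|u * (e_ k) 0 l| < delta.
  move=> ue; apply: (le_lt_trans _ ed); apply: le_trans ue; rewrite mxE/=.
  exact: norm_mul_bool.
have H1 (u : R) : `|u| <= eta -> `|partial j G (z + u *: e_ j) - eta * c| <= eps * eta.
  move=> ue; rewrite pG.
  have := @line_increment R n (partial j h) (z + u *: e_ j) i eta c eps dhj.
  rewrite (gtr0_norm e0) [c * eta]mulrC; apply => w we _; apply: hmod => k.
  rewrite mxE [(z + _) 0 k]mxE !mxE.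
  have -> : z 0 k + u * ((0 == 0 :> 'I_1) && (k == j))%:R + w * ((0 == 0 :> 'I_1) && (k == i))%:R - z 0 k =
    u * (e_ j) 0 k + w * (e_ i) 0 k by rewrite !mxE; ring.
  by apply: (le_lt_trans (ler_normD _ _)); apply: ltrD; exact: small.
have H2 : `|G (z + eta *: e_ j) - G z - eta * c * eta| <= eps * eta * eta.
  have := @line_increment R n G z j eta (eta * c) (eps * eta) dG.
  by rewrite (gtr0_norm e0); apply => u ue _; exact: H1.
have -> : fdiff eta i (fdiff eta j h) z = G (z + eta *: e_ j) - G z.
  by rewrite /G /fdiff [z + _ + _]addrAC; ring.
have -> : eta^-1 ^+ 2 * (G (z + eta *: e_ j) - G z) - c =
  eta^-1 ^+ 2 * (G (z + eta *: e_ j) - G z - eta * c * eta).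
  by field; rewrite gt_eqF.
rewrite normrM ger0_norm ?sqr_ge0// exprVn ler_pdivrMl ?exprn_gt0//.
by have -> : eta ^+ 2 * eps = eps * eta * eta by ring.
Qed.

Variable L : R.
Hypothesis L0 : 0 < L.
Let eta (N : nat) : R := 2 * L / N%:R.

Let eta_small (delta : R) : 0 < delta -> \forall N \near \oo, 0 < eta N < delta.
Proof.
move=> d0; near=> N.
have N0 : 0 < N%:R :> R by rewrite ltr0n; near: N; exact: nbhs_infty_gt.
rewrite /eta divr_gt0 ?mulr_gt0//= ltr_pdivrMr// [delta * _]mulrC -ltr_pdivrMr//.
near: N; exact: nbhs_infty_gtr.
Unshelve. all: by end_near. Qed.

(** The approximated function g may differ from f: for derivatives, g is a
difference quotient. *)
Lemma bern_cvg f (eps : R) : continuous f -> compactly_supported f -> 0 < eps ->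
  \forall N \near \oo, forall l x g,
    (forall i, (count_mem i l <= N <= (count_mem i l).+2)%N) -> in_box L x ->
    (forall z, `|g z - f z| <= eps) ->
    `|bern L (eta N) l g x - f x| <= 3 * eps.
Proof.
move=> cf sf eps0.
have [M fM] := compactly_supported_bounded cf sf.
have [delta d0 fmod] := compactly_supported_unif cf sf eps0.
set C := 2 * M / delta ^+ 2 * (n%:R * (20 * L ^+ 2)).
near=> N => l x g lN xb gf.
have N0 : (0 < N)%N by near: N; exact: nbhs_infty_gt.
have N0R : 0 < N%:R :> R by rewrite ltr0n.
have h1 := bern_approx L0 N0 (erefl (eta N)) d0 (ltW eps0) fM fmod lN xb.
have h2 : C / N%:R <= eps.
  rewrite ler_pdivrMr// [eps * _]mulrC -ler_pdivrMr//.
  near: N; exact: nbhs_infty_ger.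
have h3 : `|bern L (eta N) l g x - bern L (eta N) l f x| <= eps.
  rewrite -bernB -[X in `|X|]subr0; apply: (le_trans (bern_dist L0 _ _ _ _ xb)).
  rewrite -[leRHS](bern_cst L (eta N) l eps x); apply: bern_le => // z.
  by rewrite subr0.
have -> : bern L (eta N) l g x - f x =
  (bern L (eta N) l g x - bern L (eta N) l f x) + (bern L (eta N) l f x - f x) by ring.
apply: (le_trans (ler_normD _ _)); rewrite -/C in h1; lra.
Unshelve. all: by end_near. Qed.

Lemma all_coords_seq (N : nat) : exists l : seq 'I_n, forall i, count_mem i l = N.
Proof.
elim: N => [|N [l IH]]; first by exists [::].
exists (enum 'I_n ++ l) => i; rewrite count_cat IH count_uniq_mem ?enum_uniq//.
by rewrite mem_enum.
Qed.

(** By [partial_bern] the derivatives of the Bernstein polynomial of h are Bernstein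
sums of difference quotients of h, up to a factor k / N with k = N or N - 1 coming
from the number of steps left after the first differentiation. *)
Lemma Ck2_poly_approx h (eps : R) : C0k 2 h -> 0 < eps ->
  exists p, [/\ forall k, Ck k p,
    forall x, in_box L x -> `|p x - h x| <= eps,
    forall i x, in_box L x -> `|partial i p x - partial i h x| <= eps &
    forall i j x, in_box L x ->
      `|partial i (partial j p) x - partial i (partial j h) x| <= eps].
Proof.
move=> [h2 sh] eps0; pose e := eps / 3.
have e0 : 0 < e by rewrite divr_gt0.
have e20 : 0 < e / 2 by rewrite divr_gt0.
have ch := Ck_continuous h2.
have c1 i : continuous (partial i h) by exact: (Ck1_partial_continuous (k := 1)).
have c2 i j : continuous (partial i (partial j h)) by exact: (Ck2_partial_continuous (k := 0)).
have s1 i : compactly_supported (partial i h) by exact: partial_compactly_supported.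
have s2 i j : compactly_supported (partial i (partial j h)) by exact: partial_compactly_supported.
have A0 := bern_cvg ch sh e0.
have A1 := filter_forall _ (fun i : 'I_n => bern_cvg (c1 i) (s1 i) e0).
have A2 := filter_forall _ (fun ij : 'I_n * 'I_n => bern_cvg (c2 ij.1 ij.2) (s2 ij.1 ij.2) e0).
have B1 (i : 'I_n) : \forall N \near \oo, forall z,
    `|(eta N)^-1 * fdiff (eta N) i h z - partial i h z| <= e.
  have [delta d0 fmod] := compactly_supported_unif (c1 i) (s1 i) e0.
  near=> N => z; apply: (@fdiff_partial1 h i (eta N) delta e z) => //.
    near: N; exact: eta_small.
  by move=> x; exact: (Ck_derivable h2).
have B2 (ij : 'I_n * 'I_n) : \forall N \near \oo, forall z (k : nat), (k <= N <= k.+1)%N ->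
    `|k%:R / N%:R * (eta N)^-1 ^+ 2 * fdiff (eta N) ij.1 (fdiff (eta N) ij.2 h) z
       - partial ij.1 (partial ij.2 h) z| <= e.
  case: ij => i j /=.
  have [delta d0 fmod] := compactly_supported_unif (c2 i j) (s2 i j) e20.
  have [M hM] := compactly_supported_bounded (c2 i j) (s2 i j).
  near=> N => z k /andP[kN Nk].
  have N0 : 0 < N%:R :> R by rewrite ltr0n; near: N; exact: nbhs_infty_gt.
  set D := partial i (partial j h) z.
  set q := (eta N)^-1 ^+ 2 * fdiff (eta N) i (fdiff (eta N) j h) z.
  have q1 : `|q - D| <= e / 2.
    apply: (@fdiff_partial2 h i j (eta N) (delta / 2) (e / 2) z) => //.
      near: N; apply: eta_small; by rewrite divr_gt0.
    by rewrite -splitr.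
  have q2 : `|q| <= M + e / 2.
    have -> : q = D + (q - D) by ring.
    by apply: (le_trans (ler_normD _ _)); apply: lerD => //; exact: hM.
  have q3 : (M + e / 2) / N%:R <= e / 2.
    rewrite ler_pdivrMr// [e / 2 * _]mulrC -ler_pdivrMr//; near: N; exact: nbhs_infty_ger.
  have M0 : 0 <= M + e / 2 by apply: le_trans q2.
  have -> : k%:R / N%:R * (eta N)^-1 ^+ 2 * fdiff (eta N) i (fdiff (eta N) j h) z - D
    = (q - D) - ((N - k)%N%:R / N%:R) * q.
    by rewrite -mulrA -/q natrB//; field; rewrite gt_eqF.
  apply: (le_trans (ler_normB _ _)).
  have q4 : `|(N - k)%N%:R / N%:R * q| <= (M + e / 2) / N%:R.
    rewrite normrM ger0_norm ?divr_ge0// mulrAC ler_pM2r ?invr_gt0//.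
    rewrite -[leRHS]mul1r; apply: ler_pM => //.
    by rewrite lern1 leq_subLR addn1.
  lra.
have B1' := filter_forall _ B1.
have B2' := filter_forall _ B2.
have [M0 _ A0N] := A0; have [M1 _ A1N] := A1 _; have [M2 _ A2N] := A2 _.
have [M3 _ B1N] := B1' _; have [M4 _ B2N] := B2' _.
pose N := (M0 + M1 + M2 + M3 + M4).+1.
have N0 : (0 < N)%N by [].
have {}A0N : _ := A0N N ltac:(rewrite /N /=; lia).
have {}A1N : _ := A1N N ltac:(rewrite /N /=; lia).
have {}A2N : _ := A2N N ltac:(rewrite /N /=; lia).
have {}B1N : _ := B1N N ltac:(rewrite /N /=; lia).
have {}B2N : _ := B2N N ltac:(rewrite /N /=; lia).
clearbody N.
have N0R : N%:R != 0 :> R by rewrite pnatr_eq0 -lt0n.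
have [l lN] := all_coords_seq N.
have three : 3 * e = eps by rewrite /e mulrC divfK.
have kN : (2 * L)^-1 = (eta N)^-1 / N%:R.
  by rewrite /eta; field; rewrite N0R gt_eqF.
have cr (j : 'I_n) i : count_mem i (rem j l) = (N - (i == j))%N.
  by rewrite count_mem_rem lN eq_sym.
exists (bern L (eta N) l h); split.
- by move=> k; exact: Ck_bern.
- move=> x xb; rewrite -three; apply: A0N => //.
    by move=> i; rewrite lN leqnn/= (leq_trans (leqnSn _)).
  by move=> z; rewrite subrr normr0 ltW.
- move=> j x xb; rewrite partial_bern lN -three.
  have -> : N%:R * (2 * L)^-1 * bern L (eta N) (rem j l) (fdiff (eta N) j h) x =
     bern L (eta N) (rem j l) (fun z => (eta N)^-1 * fdiff (eta N) j h z) x.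
    by rewrite bernZ kN [N%:R * _]mulrC divfK.
  apply: A1N => //.
    by move=> i; rewrite cr leq_subr/= -addn2; case: (i == j); rewrite ?subn0 ?leq_addr// subn1; lia.
- move=> i j x xb.
  rewrite partial_bern lN.
  have -> : (fun x => N%:R * (2 * L)^-1 * bern L (eta N) (rem j l) (fdiff (eta N) j h) x) =
    bern L (eta N) (rem j l) (fun z => (N%:R * (2 * L)^-1) * fdiff (eta N) j h z).
    by apply/funext => y; rewrite bernZ.
  rewrite partial_bern cr -three.
  set k := (N - (i == j))%N.
  have -> : k%:R * (2 * L)^-1 * bern L (eta N) (rem i (rem j l))
       (fdiff (eta N) i (fun z => N%:R * (2 * L)^-1 * fdiff (eta N) j h z)) x =
     bern L (eta N) (rem i (rem j l))
       (fun z => k%:R / N%:R * (eta N)^-1 ^+ 2 * fdiff (eta N) i (fdiff (eta N) j h) z) x.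
    rewrite -bernZ; congr bern; apply/funext => z; rewrite /fdiff kN.
    move: (eta N)^-1 => w; by field.
  apply: (A2N (i, j)) => //.
    by move=> a; rewrite count_mem_rem cr; case: (a == j); case: (i == a); lia.
  move=> z; apply: (B2N (i, j)) => //.
  by rewrite /k; case: (i == j); lia.
Unshelve. all: by end_near. Qed.

End Density.

(** * Density of smooth test functions *)

Section SmoothDensity.
Variables (R : realType) (n : nat).
Implicit Types (f g h : 'rV[R]_n -> R) (i j : 'I_n) (x z : 'rV[R]_n).
Local Notation e_ i := (delta_mx 0 i : 'rV[R]_n).

Lemma partial_off_support2 h i j x :
  ~ closure [set y | h y != 0] x -> partial i (partial j h) x = 0.
Proof.
move=> nx; apply: partial_off_support => cx; apply: nx; move: cx.
rewrite [X in _ -> X x](closure_id _).1; last exact: closed_closure.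
apply: closure_subset => y /= hy; apply: contrapT => /partial_off_support h0.
by move: hy; rewrite h0 eqxx.
Qed.

Lemma Ck2_bound h : Ck 2 h -> compactly_supported h -> exists2 B : R, 0 <= B &
  [/\ forall x, `|h x| <= B, forall i x, `|partial i h x| <= B &
      forall i j x, `|partial i (partial j h) x| <= B].
Proof.
move=> h2 sh.
have [B0 HB0] := compactly_supported_bounded (Ck_continuous h2) sh.
have B1 i : exists M, forall x, `|partial i h x| <= M.
  apply: compactly_supported_bounded; last exact: partial_compactly_supported.
  exact: (Ck1_partial_continuous (k := 1)).
have B2 (ij : 'I_n * 'I_n) : exists M, forall x, `|partial ij.1 (partial ij.2 h) x| <= M.
  apply: compactly_supported_bounded.
    exact: (Ck2_partial_continuous (k := 0)).
  by apply: partial_compactly_supported; exact: partial_compactly_supported.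
have [M1 HM1] := choice B1.
have [M2 HM2] := choice B2.
have p0 : 0 <= B0 by apply: le_trans (HB0 0).
have p1 i : 0 <= M1 i by apply: le_trans (HM1 i 0).
have p2 ij : 0 <= M2 ij by apply: le_trans (HM2 ij 0).
have S1 : 0 <= \sum_i M1 i by apply: sumr_ge0.
have S2 : 0 <= \sum_ij M2 ij by apply: sumr_ge0.
exists (B0 + \sum_i M1 i + \sum_ij M2 ij); first by rewrite !addr_ge0.
split.
- by move=> x; rewrite (le_trans (HB0 x))// -addrA lerDl addr_ge0.
- move=> i x; apply: (le_trans (HM1 i x)).
  have : M1 i <= \sum_k M1 k by rewrite (bigD1 i)//= lerDl sumr_ge0.
  lra.
- move=> i j x; apply: (le_trans (HM2 (i, j) x)).
  have : M2 (i, j) <= \sum_k M2 k by rewrite (bigD1 (i, j))//= lerDl sumr_ge0.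
  lra.
Qed.

(** With chi = 1 on the support of h and p close to h on a box containing the
support of chi, chi p - h = chi (p - h); Leibniz' rule bounds its derivatives, every
term having a factor chi or a derivative of chi, which vanishes off the box. *)
Lemma C0oo_dense h (eps : R) : C0k 2 h -> 0 < eps ->
  exists phi, [/\ C0oo phi,
    forall x, `|phi x - h x| <= eps,
    forall i x, `|partial i phi x - partial i h x| <= eps &
    forall i j x, `|partial i (partial j phi) x - partial i (partial j h) x| <= eps].
Proof.
move=> h20 eps0; have [h2 sh] := h20.
have [a a0 ha] := compactly_supported_in_box sh.
pose L := a + 1; have L0 : 0 < L by rewrite addr_gt0.
pose chi := @cutoff R n a.
have Cchi k : Ck k chi by exact: Ck_cutoff.
have [schi ochi] : compactly_supported chi /\
   (forall x i, L < `|x 0 i| -> ~ closure [set y | chi y != 0] x).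
  by apply: box_compactly_supported => x i; exact: cutoff0.
have [B B0 [Bc Bc1 Bc2]] := Ck2_bound (Cchi 2) schi.
(* 4 is the number of terms in the second derivative of a product. *)
pose e := eps / (4 * (B + 1)).
have B10 : 0 < 4 * (B + 1) by rewrite mulr_gt0// ltr_wpDl.
have e0 : 0 < e by rewrite divr_gt0.
have Be : 4 * (B * e) <= eps.
  have -> : eps = 4 * (B + 1) * e by rewrite /e mulrC divfK// gt_eqF.
  by rewrite mulrA ler_wpM2r ?(ltW e0)// ler_wpM2l// lerDl.
have Be0 : 0 <= B * e by rewrite mulr_ge0// ltW.
have [p [Cp p0 p1 p2]] := Ck2_poly_approx L0 h20 e0.
pose u x := p x - h x.
have u2 : Ck 2 u by exact: (Ck_sub (Cp 2) h2).
have dh i x : derivable h x (e_ i) by exact: (Ck_derivable h2).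
have dp i x : derivable p x (e_ i) by exact: (Ck_derivable (Cp 2)).
have dh1 i j x : derivable (partial j h) x (e_ i) by exact: (Ck_derivable (Ck_partial j h2)).
have dp1 i j x : derivable (partial j p) x (e_ i) by exact: (Ck_derivable (Ck_partial j (Cp 2))).
have du i x : derivable u x (e_ i) by exact: (Ck_derivable u2).
have du1 i j x : derivable (partial j u) x (e_ i) by exact: (Ck_derivable (Ck_partial j u2)).
have dc i x : derivable chi x (e_ i) by exact: (Ck_derivable (Cchi 1)).
have dc1 i j x : derivable (partial j chi) x (e_ i) by exact: (Ck_derivable (Ck_partial j (Cchi 2))).
have pu i : partial i u = fun x => partial i p x - partial i h x by exact: partialB.
pose phi x := chi x * p x.
have Cphi k : Ck k phi by exact: (Ck_mul (Cchi k) (Cp k)).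
have dphi i x : derivable phi x (e_ i) by exact: (Ck_derivable (Cphi 1)).
have dphi1 i j x : derivable (partial j phi) x (e_ i) by exact: (Ck_derivable (Ck_partial j (Cphi 2))).
have phiE : (fun x => phi x - h x) = (fun x => chi x * u x).
  apply/funext => x; rewrite /phi /u mulrBr; congr (_ - _).
  have [->|hx] := eqVneq (h x) 0; first by rewrite mulr0.
  by rewrite /chi cutoff1 ?mul1r//; exact: ha.
have E1 i : (fun x => partial i phi x - partial i h x) =
    (fun x => chi x * partial i u x + u x * partial i chi x).
  by rewrite -(partialB (dphi i) (dh i)) phiE; exact: partialM.
have E2 i j : (fun x => partial i (partial j phi) x - partial i (partial j h) x) =
    (fun x => (chi x * partial i (partial j u) x + partial j u x * partial i chi x) +
       (u x * partial i (partial j chi) x + partial j chi x * partial i u x)).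
  rewrite -(partialB (dphi1 i j) (dh1 i j)) E1 partialD; last 2 first.
  - by move=> x; apply: derivableM.
  - by move=> x; apply: derivableM.
  by rewrite (partialM (dc i) (du1 i j)) (partialM (du i) (dc1 i j)).
have bnd x (c v : R) : `|c| <= B -> (in_box L x -> `|v| <= e) -> (~ in_box L x -> c = 0) ->
    `|c * v| <= B * e.
  move=> cB vb cb; have [xb|xb] := pselect (in_box L x).
    by rewrite normrM; apply: ler_pM => //; exact: vb.
  by rewrite cb// mul0r normr0.
have off x : ~ in_box L x -> ~ closure [set y | chi y != 0] x.
  move=> xb; have [i Li] : exists i, L < `|x 0 i|.
    apply: contrapT => H; apply: xb => i; rewrite leNgt; apply/negP => Hi.
    by apply: H; exists i.
  exact: ochi Li.
have b0 x v : (in_box L x -> `|v| <= e) -> `|chi x * v| <= B * e.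
  by move=> Hv; apply: (bnd x) => // /off; exact: zero_off_support.
have b1 i x v : (in_box L x -> `|v| <= e) -> `|v * partial i chi x| <= B * e.
  by move=> Hv; rewrite mulrC; apply: (bnd x) => // /off; exact: partial_off_support.
have b2 i j x v : (in_box L x -> `|v| <= e) -> `|v * partial i (partial j chi) x| <= B * e.
  by move=> Hv; rewrite mulrC; apply: (bnd x) => // /off; exact: partial_off_support2.
have v0 x : in_box L x -> `|u x| <= e by exact: p0.
have v1 i x : in_box L x -> `|partial i u x| <= e by rewrite pu; exact: p1.
have v2 i j x : in_box L x -> `|partial i (partial j u) x| <= e.
  rewrite pu (partialB (dp1 i j) (dh1 i j)); exact: p2.
exists phi; split.
- split=> //; apply: compactly_supported_sub schi => x /zero_off_support c0.
  by rewrite /phi c0 mul0r.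
- move=> x; have := congr1 (fun F : 'rV[R]_n -> R => F x) phiE => /= ->.
  by apply: le_trans Be; rewrite (le_trans (b0 _ _ (v0 x)))//; lra.
- move=> i x; have := congr1 (fun F : 'rV[R]_n -> R => F x) (E1 i) => /= ->.
  apply: (le_trans (ler_normD _ _)).
  have Be2 : B * e + B * e <= eps by lra.
  by apply: le_trans Be2; apply: lerD; [exact: b0 (v1 i x)|exact: b1 (v0 x)].
- move=> i j x; have := congr1 (fun F : 'rV[R]_n -> R => F x) (E2 i j) => /= ->.
  apply: (le_trans (ler_normD _ _)).
  apply: (le_trans (lerD (ler_normD _ _) (ler_normD _ _))); apply: le_trans Be.
  rewrite (_ : 4 * (B * e) = (B * e + B * e) + (B * e + B * e)); last by ring.
  apply: lerD; apply: lerD.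
  + exact: b0 (v2 i j x).
  + exact: b1 (v1 j x).
  + exact: b2 (v0 x).
  + by rewrite mulrC; exact: b1 (v1 i x).
Qed.

End SmoothDensity.

(** * Size of the operator L *)

Definition op_const (R : realType) (d m : nat) : R :=
  d%:R * (d%:R * m%:R) + d%:R + 1.

Lemma op_const_gt0 (R : realType) (d m : nat) : 0 < op_const R d m.
Proof. by rewrite ltr_wpDl// addr_ge0// !mulr_ge0. Qed.

Section Operator.
Variables (R : realType) (d m : nat).
Local Notation V := 'rV[R]_d.
Local Notation P := (prob R V).
Variables (b : R -> V -> P -> V) (sigma : R -> V -> P -> 'M[R]_(d, m)).

Lemma entry_le_fnorm (p q : nat) (A : 'M[R]_(p, q)) i j : `|A i j| <= fnorm A.
Proof.
rewrite -sqrtr_sqr ler_wsqrtr// (bigD1 i)//= (bigD1 j)//= -addrA lerDl.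
by rewrite addr_ge0// ?sumr_ge0// => k _; rewrite ?sqr_ge0// sumr_ge0// => l _; exact: sqr_ge0.
Qed.

Lemma second_order_bound t mu x (q : 'I_d -> 'I_d -> R) (p : 'I_d -> R) (e : R) :
  0 <= e -> (forall i j, `|q i j| <= e) -> (forall i, `|p i| <= e) ->
  `|2^-1 * (\sum_i \sum_j (sigma t x mu *m (sigma t x mu)^T) i j * q i j)
    + \sum_i b t x mu 0 i * p i| <= e * op_const R d m * coeff_size b sigma t mu x.
Proof.
move=> e0 qe pe; set S := sigma t x mu.
have S0 : 0 <= fnorm S ^+ 2 by rewrite sqr_ge0.
have b0 : 0 <= fnorm (b t x mu) by rewrite sqrtr_ge0.
have SS i j : `|(S *m S^T) i j| <= m%:R * fnorm S ^+ 2.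
  rewrite mxE; apply: (le_trans (ler_norm_sum _ _ _)).
  rewrite -[m in m%:R]card_ord -sum1_card natr_sum mulr_suml; apply: ler_sum => k _.
  rewrite mul1r normrM mxE expr2; apply: ler_pM => //; exact: entry_le_fnorm.
have h1 : `|\sum_i \sum_j (S *m S^T) i j * q i j| <= d%:R * (d%:R * m%:R) * (fnorm S ^+ 2 * e).
  apply: (le_trans (ler_norm_sum _ _ _)).
  rewrite -mulrA -[X in X%:R * _]card_ord -sum1_card natr_sum mulr_suml; apply: ler_sum => i _.
  apply: (le_trans (ler_norm_sum _ _ _)).
  rewrite mul1r -mulrA -[X in X%:R * _]card_ord -sum1_card natr_sum mulr_suml; apply: ler_sum => j _.
  by rewrite mul1r normrM mulrA; apply: ler_pM.
have h2 : `|\sum_i b t x mu 0 i * p i| <= d%:R * (fnorm (b t x mu) * e).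
  apply: (le_trans (ler_norm_sum _ _ _)).
  rewrite -[X in X%:R * _]card_ord -sum1_card natr_sum mulr_suml; apply: ler_sum => i _.
  rewrite mul1r normrM; apply: ler_pM => //; exact: entry_le_fnorm.
apply: (le_trans (ler_normD _ _)); rewrite normrM ger0_norm ?invr_ge0//.
rewrite /coeff_size -/S /op_const.
set X := `|_| in h1 *; set Y := `|_| in h2 *.
set f1 := fnorm S ^+ 2 in S0 h1 *; set f2 := fnorm _ in b0 h2 *.
have X0 : 0 <= X by rewrite /X.
set D1 := d%:R * (d%:R * m%:R) in h1 *; set D2 := d%:R in h2 *.
have D10 : 0 <= D1 by rewrite /D1 !mulr_ge0.
have D20 : 0 <= D2 by rewrite /D2.
have -> : e * (D1 + D2 + 1) * (f2 + f1) = D1 * (f1 * e) + D2 * (f2 * e) +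
  (D1 * (f2 * e) + D2 * (f1 * e) + e * (f2 + f1)) by ring.
have r0 : 0 <= D1 * (f2 * e) + D2 * (f1 * e) + e * (f2 + f1).
  by apply: addr_ge0; [apply: addr_ge0; apply: mulr_ge0 => //; apply: mulr_ge0|apply: mulr_ge0 => //; apply: addr_ge0].
lra.
Qed.

Lemma Lop_bound t mu x (h : V -> R) (e : R) : 0 <= e ->
  (forall i x, `|partial i h x| <= e) ->
  (forall i j x, `|partial i (partial j h) x| <= e) ->
  `|Lop b sigma t mu h x| <= e * op_const R d m * coeff_size b sigma t mu x.
Proof. by move=> e0 h1 h2; exact: second_order_bound. Qed.

Lemma Lop_dist t mu x (g h : V -> R) (e : R) : 0 <= e ->
  (forall i x, `|partial i g x - partial i h x| <= e) ->
  (forall i j x, `|partial i (partial j g) x - partial i (partial j h) x| <= e) ->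
  `|Lop b sigma t mu g x - Lop b sigma t mu h x| <= e * op_const R d m * coeff_size b sigma t mu x.
Proof.
move=> e0 h1 h2.
have -> : Lop b sigma t mu g x - Lop b sigma t mu h x =
  2^-1 * (\sum_i \sum_j (sigma t x mu *m (sigma t x mu)^T) i j *
     (partial i (partial j g) x - partial i (partial j h) x))
    + \sum_i b t x mu 0 i * (partial i g x - partial i h x).
  rewrite /Lop.
  have -> : \sum_i b t x mu 0 i * (partial i g x - partial i h x) =
    \sum_i b t x mu 0 i * partial i g x - \sum_i b t x mu 0 i * partial i h x.
    by rewrite -sumrB; apply: eq_bigr => i _; rewrite mulrBr.
  have -> : \sum_i \sum_j (sigma t x mu *m (sigma t x mu)^T) i j *
     (partial i (partial j g) x - partial i (partial j h) x) =
    \sum_i \sum_j (sigma t x mu *m (sigma t x mu)^T) i j * partial i (partial j g) x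
    - \sum_i \sum_j (sigma t x mu *m (sigma t x mu)^T) i j * partial i (partial j h) x.
    rewrite -sumrB; apply: eq_bigr => i _; rewrite -sumrB; apply: eq_bigr => j _.
    by rewrite mulrBr.
  by rewrite opprD addrACA mulrBr.
exact: second_order_bound.
Qed.

End Operator.

(** Freezing the path before time s gives a path that is continuous on the whole
line, which avoids working on a subspace. *)
Lemma continuous_clamped (R : realType) (T : topologicalType) (s : R) (f : R -> T) :
  {within `[s, +oo[, continuous f} -> continuous (fun r => f (Num.max r s)).
Proof.
move=> /subspace_continuousP cf r.
have sr : `[s, +oo[%classic (Num.max r s) by rewrite /= in_itv/= le_max lexx orbT.
move=> A /(cf _ sr); rewrite /within/= => HA.
have cm : (Num.max r' s) @[r' --> r] --> Num.max r s.
  apply: (@continuous_max R R id (fun=> s) r); first exact: cvg_id.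
  exact: cst_continuous.
apply: (@filterS R (nbhs r) _ _ _ _ (cm _ HA)) => r' /=; apply.
by rewrite in_itv/= le_max lexx orbT.
Qed.

(** * Equivalence of the two equations *)

Lemma le_abse_fine (R : realType) (x : \bar R) : (`|(fine x)%:E| <= `|x|)%E.
Proof. by case: x => [r| |] //=; rewrite normr0 leey. Qed.

Lemma Rintegral_dist_le (R : realType) (T : ptopologicalType) (mu : prob R T)
  (f g : T -> R) (e : R) : continuous f -> continuous g -> bounded_fun f ->
  bounded_fun g -> (forall x, `|f x - g x| <= e) ->
  `|\int[mu]_x f x - \int[mu]_x g x| <= e.
Proof.
move=> cf cg bf bg fg.
have fi := bcfun_integrable mu (BCFun cf bf).
have gi := bcfun_integrable mu (BCFun cg bg).
rewrite -RintegralB//.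
have fgi := real_integrableB measurableT fi gi.
apply: (le_trans (le_normr_Rintegral measurableT fgi)).
have ci : mu.-integrable setT (EFin \o (cst e : borel T -> R)).
  exact: (@finite_measure_integrable_cst _ _ _ mu setT e).
apply: (@le_trans _ _ (\int[mu]_(x in setT) (cst e : borel T -> R) x)).
  apply: le_Rintegral => //; first exact: integrable_norm.
have -> : \int[mu]_x (cst e : borel T -> R) x = e * fine (1 : \bar R)%E.
  by rewrite Rintegral_cst//; congr (_ * fine _); exact: probability_setT.
by rewrite mulr1.
Qed.

Lemma dist_equations (R : realType) (a b c a' b' c' e e' w : R) : a' = b' + c' ->
  `|a' - a| <= e -> `|b' - b| <= e' -> `|c' - c| <= w ->
  `|a - (b + c)| <= e + e' + w.
Proof.
move=> -> h1 h2 h3.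
rewrite (_ : a - (b + c) = (b' - b) + (c' - c) - (b' + c' - a)); last by ring.
apply: (le_trans (ler_normB _ _)).
have := ler_normD (b' - b) (c' - c); lra.
Qed.

Section Path.
Variables (R : realType) (d m : nat).
Local Notation V := 'rV[R]_d.
Local Notation P := (prob R V).
Variables (b : R -> V -> P -> V) (sigma : R -> V -> P -> 'M[R]_(d, m)).
Hypothesis hb : borel_fun [set z : R * V * P | 0 <= z.1.1]
  (fun z => b z.1.1 z.1.2 z.2).
Hypothesis hsigma : borel_fun [set z : R * V * P | 0 <= z.1.1]
  (fun z => sigma z.1.1 z.1.2 z.2).
Variables (s : R) (mu : R -> P).
Hypothesis s0 : 0 <= s.
Hypothesis cmu : weakly_continuous_from s mu.
Local Notation leb := (@lebesgue_measure R).

(* Time and path are frozen before s, so that the coefficients are only evaluated at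
nonnegative times; nothing changes on [s, +oo[. *)
Let tau (r : R) := Num.max r s.
Let nu (r : R) : P := mu (tau r).

Let tau0 r : 0 <= tau r.
Proof. by rewrite (le_trans s0)// le_max lexx orbT. Qed.

Let tauc : continuous tau.
Proof.
move=> r; apply: (@continuous_max R R id (fun=> s) r); first exact: cvg_id.
exact: cst_continuous.
Qed.

Let nuc : continuous nu.
Proof. exact: continuous_clamped. Qed.

Let tauE r : s <= r -> tau r = r.
Proof. by move=> sr; rewrite /tau max_l. Qed.

Let csize (r : R) : \bar R := (\int[nu r]_x (coeff_size b sigma (tau r) (nu r) x)%:E)%E.
Let drift (h : V -> R) (r : R) : R := \int[nu r]_x Lop b sigma (tau r) (nu r) h x.

Let csize_ge0 r : (0 <= csize r)%E.
Proof. by apply: integral_ge0 => x _; rewrite lee_fin coeff_size_ge0. Qed.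

Let msize : measurable_fun setT csize.
Proof.
have := measurable_along_int_size hb hsigma tau0 tauc nuc => H.
apply: (measurableT_comp H (g := (id : R -> borel R))).
by apply: measurable_borelR; exact: measurable_id.
Qed.

Let mdrift (h : V -> R) : Ck 2 h -> measurable_fun setT (drift h).
Proof.
move=> h2.
have := @measurable_along_int_Lop R d m b sigma hb hsigma R tau nu tau0 tauc nuc h
  (fun i => Ck1_partial_continuous h2) (fun i j => Ck2_partial_continuous h2) => H.
apply: (measurableT_comp H (g := (id : R -> borel R))).
by apply: measurable_borelR; exact: measurable_id.
Qed.

Let mLop r (h : V -> R) : Ck 2 h ->
  measurable_fun setT (Lop b sigma (tau r) (nu r) h : borel V -> R).
Proof.
move=> h2.
have H := @measurable_along_Lop R d m b sigma hb hsigma R tau nu tau0 tauc nuc h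
  (fun i => Ck1_partial_continuous h2) (fun i j => Ck2_partial_continuous h2).
exact: (measurable_fun_pair2 (r : borel R) H).
Qed.

Let msize_x r : measurable_fun setT (coeff_size b sigma (tau r) (nu r) : borel V -> R).
Proof.
have H := @measurable_along_size R d m b sigma hb hsigma R tau nu tau0 tauc nuc.
exact: (measurable_fun_pair2 (r : borel R) H).
Qed.

Let K := op_const R d m.
Let K0 : 0 < K. Proof. exact: op_const_gt0. Qed.

Let int_le_csize r (f : V -> R) (c : R) : 0 <= c ->
  measurable_fun setT (f : borel V -> R) ->
  (forall x, `|f x| <= c * coeff_size b sigma (tau r) (nu r) x) ->
  (\int[nu r]_x `|(f x)%:E| <= c%:E * csize r)%E.
Proof.
move=> c0 mf fc; rewrite /csize -ge0_integralZl_EFin//; last 2 first.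
- by move=> x _; rewrite lee_fin coeff_size_ge0.
- exact/measurable_EFinP.
apply: ge0_le_integral => //.
- by apply: measurableT_comp => //; exact/measurable_EFinP.
- by apply: measurable_funeM; exact/measurable_EFinP.
- by move=> x _; rewrite -EFinM lee_fin.
Qed.

Let drift_bound (h : V -> R) : C0k 2 h -> exists2 c : R, 0 <= c &
  forall r, (`|(drift h r)%:E| <= c%:E * csize r)%E.
Proof.
move=> [h2 sh]; have [B B0 [_ B1 B2]] := Ck2_bound h2 sh.
exists (B * K); first by rewrite mulr_ge0// ltW.
move=> r; apply: (le_trans (le_abse_fine _)).
have mL := mLop r h2.
apply: (le_trans (le_abse_integral _ measurableT _)); first exact/measurable_EFinP.
apply: int_le_csize => //; first by rewrite mulr_ge0// ltW.
by move=> x; exact: Lop_bound.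
Qed.

(** The bound holds for every r: where csize r is infinite the right-hand side is
infinite, as e > 0, and elsewhere both functions are integrable. *)
Let drift_dist (g h : V -> R) (e : R) : Ck 2 g -> compactly_supported g -> C0k 2 h -> 0 < e ->
  (forall i x, `|partial i g x - partial i h x| <= e) ->
  (forall i j x, `|partial i (partial j g) x - partial i (partial j h) x| <= e) ->
  forall r, (`|(drift g r - drift h r)%:E| <= (e * K)%:E * csize r)%E.
Proof.
move=> g2 sg [h2 sh] e0 gh1 gh2 r.
have eK0 : 0 < e * K by rewrite mulr_gt0.
have [->|cfin] := eqVneq (csize r) +oo%E.
  by rewrite gt0_muley ?lte_fin// leey.
have integ (f : V -> R) : Ck 2 f -> compactly_supported f ->
    (nu r).-integrable setT (EFin \o (Lop b sigma (tau r) (nu r) f : borel V -> R)).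
  move=> f2 sf; have [B B0 [_ B1 B2]] := Ck2_bound f2 sf.
  apply/integrableP; split; first by apply/measurable_EFinP; exact: mLop.
  apply: (@le_lt_trans _ _ ((B * K)%:E * csize r)%E).
    apply: int_le_csize => //; [by rewrite mulr_ge0// ltW|exact: mLop|].
    by move=> x; exact: Lop_bound.
  rewrite -(fineK (x := csize r)); first by rewrite -EFinM ltry.
  by rewrite ge0_fin_numE// ltey.
have ig := integ g g2 sg; have ih := integ h h2 sh.
rewrite /drift -RintegralB//.
apply: (le_trans (le_abse_fine _)).
have mB : measurable_fun setT (fun x : borel V => Lop b sigma (tau r) (nu r) g x - Lop b sigma (tau r) (nu r) h x).
  by apply: measurable_funB; exact: mLop.
apply: (le_trans (le_abse_integral _ measurableT _)); first exact/measurable_EFinP.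
apply: int_le_csize => //; first exact: ltW.
by move=> x; apply: Lop_dist => //; exact: ltW.
Qed.

Let csize_int t : (\int[leb]_(r in `[s, t]) \int[mu r]_x (coeff_size b sigma r (mu r) x)%:E
  = \int[leb]_(r in `[s, t]) csize r)%E.
Proof.
apply: eq_integral => r; rewrite inE/= in_itv/= => /andP[sr _].
by rewrite /csize /nu tauE.
Qed.

Let drift_int t h : \int[leb]_(r in `[s, t]) \int[mu r]_x Lop b sigma r (mu r) h x
  = \int[leb]_(r in `[s, t]) drift h r.
Proof.
apply: eq_Rintegral => r; rewrite inE/= in_itv/= => /andP[sr _].
by rewrite /drift /nu tauE.
Qed.

Section FiniteSize.
Variable t : R.
Hypothesis size_fin : (\int[leb]_(r in `[s, t]) csize r < +oo)%E.

Let drift_integrable h : C0k 2 h -> leb.-integrable `[s, t] (EFin \o drift h).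
Proof.
move=> h2; have [c c0 Hc] := drift_bound h2.
have mh : measurable_fun `[s, t] (drift h) by apply: measurable_funTS; apply: mdrift; case: h2.
apply/integrableP; split; first exact/measurable_EFinP.
apply: (@le_lt_trans _ _ (c%:E * \int[leb]_(r in `[s, t]) csize r)%E).
  rewrite -ge0_integralZl_EFin//; last exact: measurable_funTS.
  apply: ge0_le_integral => //.
  - by apply: measurableT_comp => //; exact/measurable_EFinP.
  - by apply: measurable_funeM; exact: measurable_funTS.
  - by move=> r _; exact: Hc.
rewrite -(fineK (x := (\int[leb]_(r in `[s, t]) csize r)%E)).
  by rewrite -EFinM ltry.
by rewrite ge0_fin_numE// integral_ge0.
Qed.

Let S := fine (\int[leb]_(r in `[s, t]) csize r)%E.

Let drift_int_dist (g h : V -> R) (e : R) : C0k 2 g -> C0k 2 h -> 0 < e ->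
  (forall i x, `|partial i g x - partial i h x| <= e) ->
  (forall i j x, `|partial i (partial j g) x - partial i (partial j h) x| <= e) ->
  `|\int[leb]_(r in `[s, t]) drift g r - \int[leb]_(r in `[s, t]) drift h r| <= e * K * S.
Proof.
move=> Cg Ch e0 gh1 gh2.
have ig := drift_integrable Cg; have ih := drift_integrable Ch.
rewrite -(@RintegralB _ _ _ leb `[s, t]%classic _ _ _ ig ih)// -lee_fin.
have mB : measurable_fun `[s, t] (fun r => drift g r - drift h r).
  by apply: measurable_funB; apply: measurable_funTS; apply: mdrift; [case: Cg|case: Ch].
apply: (le_trans (le_abse_fine _)).
apply: (le_trans (le_abse_integral _ _ _)) => //; first exact/measurable_EFinP.
rewrite EFinM /S fineK; last by rewrite ge0_fin_numE// integral_ge0.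
rewrite -ge0_integralZl_EFin//; last 2 first.
- exact: measurable_funTS.
- by rewrite mulr_ge0// ltW.
apply: ge0_le_integral => //.
- by apply: measurableT_comp => //; exact/measurable_EFinP.
- by apply: measurable_funeM; exact: measurable_funTS.
- by move=> r _; have [g2 sg] := Cg; exact: drift_dist.
Qed.

(** Each term of the equation is continuous for the convergence of [C0oo_dense]. *)
Lemma smooth_to_C2_equation :
  (forall h, C0oo h -> \int[mu t]_x h x = \int[mu s]_x h x
     + \int[leb]_(r in `[s, t]) drift h r) ->
  forall h, C0k 2 h -> \int[mu t]_x h x = \int[mu s]_x h x
     + \int[leb]_(r in `[s, t]) drift h r.
Proof.
move=> Hoo h Ch; have [h2 sh] := Ch.
have ch := Ck_continuous h2.
have bh := compactly_supported_bounded_fun ch sh.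
have S0 : 0 <= S by rewrite fine_ge0// integral_ge0.
apply/eqP; rewrite -subr_eq0 -normr_le0.
apply/ler_addgt0Pl => eps eps0; rewrite addr0.
pose e := eps / (2 + K * S).
have D0 : 0 < 2 + K * S by rewrite ltr_pwDl// mulr_ge0// ltW.
have e0 : 0 < e by rewrite divr_gt0.
have [phi [[Cphi sphi] p0 p1 p2]] := C0oo_dense Ch e0.
have cphi := Ck_continuous (Cphi 2).
have bphi := compactly_supported_bounded_fun cphi sphi.
have E := Hoo phi (conj Cphi sphi).
have i1 := Rintegral_dist_le (mu t) cphi ch bphi bh p0.
have i2 := Rintegral_dist_le (mu s) cphi ch bphi bh p0.
have i3 := drift_int_dist (conj (Cphi 2) sphi) Ch e0 p1 p2.
have epsE : eps = e + e + e * K * S.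
  have -> : eps = e * (2 + K * S) by rewrite /e divfK// gt_eqF.
  by ring.
by rewrite epsE; exact: (dist_equations E).
Qed.

Lemma chain_rule_C2 (n : nat) (g : 'rV[R]_n -> R) (h : 'I_n -> V -> R) : s <= t ->
  (forall u, s <= u <= t -> forall i, \int[mu u]_x h i x = \int[mu s]_x h i x
     + \int[leb]_(r in `[s, u]) drift (h i) r) ->
  Ck 1 g -> (forall i, C0k 2 (h i)) ->
  cyl g h (mu t) = cyl g h (mu s)
    + \int[leb]_(r in `[s, t]) bfLop b sigma r g h (mu r).
Proof.
move=> st Hh g1 Ch.
have cy : continuous (fun r => moments h (nu r)).
  move=> r; apply: (@continuous_comp _ _ _ nu (moments h)); first exact: nuc.
  by apply: continuous_moments => i; have [Ci si] := Ch i => //; exact: Ck_continuous Ci.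
have nuE u : s <= u -> nu u = mu u by move=> su; rewrite /nu tauE.
have yE i u : s <= u <= t -> moments h (nu u) 0 i =
    moments h (nu s) 0 i + \int[leb]_(r in `[s, u]) drift (h i) r.
  by move=> sut; have /andP[su _] := sut; rewrite !mxE (nuE _ su) (nuE _ (lexx s)) Hh.
have E := @chain_rule_integral R n g s t (fun r => moments h (nu r))
  (fun i => drift (h i)) st g1 cy (fun i => drift_integrable (Ch i)) yE.
rewrite /cyl -(nuE _ st) -(nuE _ (lexx s)) E; congr (_ + _).
apply: eq_Rintegral => r; rewrite inE/= in_itv/= => /andP[sr _].
apply: eq_bigr => i _; rewrite (nuE _ sr); congr (_ * _).
by rewrite /drift (nuE _ sr) (tauE sr).
Qed.

End FiniteSize.

Lemma nonlinear_to_chain_rule :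
  nonlinear_FPE_solution b sigma s mu -> chain_rule_along b sigma s mu.
Proof.
move=> [_ H].
have fin t : s <= t -> (\int[leb]_(r in `[s, t]) csize r < +oo)%E.
  by move=> st; have [+ _] := H t st; rewrite csize_int.
move=> t st; split; first by rewrite csize_int; exact: fin.
move=> n g h _ [g1 _ _] Ch; apply: chain_rule_C2 => //; first exact: fin.
move=> u /andP[su ut] i; apply: smooth_to_C2_equation => //; first exact: fin.
by move=> f Cf; rewrite -drift_int; have [_ ->] := H u su.
Qed.

(** With g(x) = x near [-M, M], where M bounds |h|, the chain rule for g and h is the
equation for h. *)
Lemma chain_rule_to_nonlinear :
  chain_rule_along b sigma s mu -> nonlinear_FPE_solution b sigma s mu.
Proof.
move=> H; split=> // t st; have [Hfin Heq] := H t st; split=> // h [Ch sh].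
have ch := Ck_continuous (Ch 0).
have [M hM] := compactly_supported_bounded ch sh.
have M0 : 0 <= M by apply: le_trans (hM 0).
pose a := M + 1.
pose g (x : 'rV[R]_1) := x 0 0 * cutoff a x.
have Cg k : Ck k g by exact: (Ck_mul (@Ck_coord R 1 k 0) (@Ck_cutoff R 1 k a)).
have [sg _] : compactly_supported g /\
   (forall (x : 'rV[R]_1) i, a + 1 < `|x 0 i| -> ~ closure [set y | g y != 0] x).
  by apply: box_compactly_supported => x i ax; rewrite /g (cutoff0 ax) mulr0.
have Hg : Cb1 g.
  split; first exact: Cg.
    exact: (compactly_supported_bounded_fun (Ck_continuous (Cg 1)) sg).
  move=> i; apply: compactly_supported_bounded_fun.
    exact: (Ck1_partial_continuous (Cg 1)).
  exact: partial_compactly_supported.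
pose h1 (_ : 'I_1) := h.
have := Heq 1%N g h1 (ltnSn _) Hg (fun=> conj (Ch 2) sh).
have mom r : `|moments h1 (mu r) 0 0| <= M.
  have b0 : bounded_fun (fun _ : V => 0 : R).
    by exists 0; split=> // N N0 x _ /=; rewrite normr0 ltW.
  have := @Rintegral_dist_le R V (mu r) h (fun=> 0) M ch (@cst_continuous _ _ 0)
    (compactly_supported_bounded_fun ch sh) b0.
  rewrite mxE Rintegral_cst// mul0r subr0; apply => x.
  by rewrite subr0.
have cylE r : cyl g h1 (mu r) = \int[mu r]_x h x.
  rewrite /cyl /g cutoff1; first by rewrite mulr1 mxE.
  by move=> i; rewrite (ord1 i) (le_trans (mom r))// lerDl.
have gE r : partial 0 g (moments h1 (mu r)) = 1.
  have yM := mom r; move: (moments h1 (mu r)) yM => y yM.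
  have gy : \near y, g y = (fun x : 'rV[R]_1 => x 0 0) y.
    have ya : `|y 0 0| < a by rewrite (le_lt_trans yM)// ltrDl.
    have cn : {for y, continuous (fun x : 'rV[R]_1 => `|x 0 0|)}.
      by apply: continuous_comp; [exact: coord_continuous|exact: norm_continuous].
    near=> z; rewrite /g cutoff1 ?mulr1// => i; rewrite (ord1 i) ltW//.
    by near: z; exact: (cn _ (lt_nbhsl ya)).
  rewrite /partial (near_eq_derive _ gy) -[LHS]/(partial 0 (fun x : 'rV[R]_1 => x 0 0) y).
  by rewrite partial_coord.
rewrite !cylE => ->; congr (_ + _); apply: eq_Rintegral => r _.
by rewrite /bfLop big_ord1 gE mul1r.
Unshelve. all: by end_near. Qed.

End Path.

Theorem proposition3p1 (R : realType) (d m : nat)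
  (b : R -> 'rV[R]_d -> prob R 'rV[R]_d -> 'rV[R]_d)
  (sigma : R -> 'rV[R]_d -> prob R 'rV[R]_d -> 'M[R]_(d, m))
  (hb : borel_fun [set z : R * 'rV[R]_d * prob R 'rV[R]_d | 0 <= z.1.1]
          (fun z => b z.1.1 z.1.2 z.2))
  (hsigma : borel_fun [set z : R * 'rV[R]_d * prob R 'rV[R]_d | 0 <= z.1.1]
          (fun z => sigma z.1.1 z.1.2 z.2))
  (s : R) (hs : 0 <= s)
  (mu : R -> prob R 'rV[R]_d) (hmu : weakly_continuous_from s mu) :
  nonlinear_FPE_solution b sigma s mu <->
  linear_FPE_solution b sigma s (fun t => pdirac R (mu t)).
Proof.
rewrite (linear_FPE_pdirac hb hsigma hs hmu); split.
  exact: nonlinear_to_chain_rule.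
exact: chain_rule_to_nonlinear.
Qed.
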